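(* Let $A\subset\mathbb{Z}^d$ be a spectral set in $\mathbb{Z}^d$ with $|A|\le 5$. Then $A$ tiles $\mathbb{Z}^d$ by translation.
   Context: The characters of $\mathbb{Z}^d$ are identified with points $\lambda\in\mathbb{T}^d=\mathbb{R}^d/\mathbb{Z}^d$ via $x\mapsto e^{2\pi i\lambda\cdot x}$. A finite set $A\subset\mathbb{Z}^d$ is spectral if there exists $\Lambda\subset\mathbb{T}^d$ such that the functions $x\mapsto e^{2\pi i\lambda\cdot x}$, $\lambda\in\Lambda$, form an orthogonal basis of $\ell^2(A)$ (counting measure). $A$ tiles $\mathbb{Z}^d$ by translation if there exists $T\subseteq\mathbb{Z}^d$ with $\sum_{t\in T}\chi_A(x-t)=1$ for all $x\in\mathbb{Z}^d$. *)

(* Defs.v *)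
From HB Require Import structures.
From mathcomp Require Import all_boot all_order all_algebra.
From mathcomp Require Import reals trigo.
From mathcomp Require Import complex.
Set Implicit Arguments. Unset Strict Implicit. Unset Printing Implicit Defensive.
Import Order.TTheory GRing.Theory Num.Theory.
Local Open Scope ring_scope.

(* Points of Z^d are row vectors 'rV[int]_d; a character of Z^d is given by
   lambda in T^d = R^d/Z^d, represented by its unique representative in
   [0,1)^d, as a row vector 'rV[R]_d. *)

Section Defs.
Variable R : realType.

Definition dotZ d (l : 'rV[R]_d) (x : 'rV[int]_d) : R :=
  \sum_(i < d) l 0 i * (x 0 i)%:~R.

Definition echar d (l : 'rV[R]_d) (x : 'rV[int]_d) : R[i] :=
  Complex (cos (2 * pi * dotZ l x)) (sin (2 * pi * dotZ l x)).

Definition in_torus d (l : 'rV[R]_d) : bool :=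
  [forall i, (0 <= l 0 i) && (l 0 i < 1)].

(* inner product of l^2(A) (counting measure), A a finite set given as a
   duplicate-free list *)
Definition l2dot d (A : seq 'rV[int]_d) (f g : 'rV[int]_d -> R[i]) : R[i] :=
  \sum_(a <- A) f a * (g a)^*.

Definition orth_basis_exps d (A : seq 'rV[int]_d) (Lam : seq 'rV[R]_d) : Prop :=
  [/\ {in Lam &, forall l m, l != m -> l2dot A (echar l) (echar m) = 0},
      (forall c : 'rV[R]_d -> R[i],
         {in A, forall a, \sum_(l <- Lam) c l * echar l a = 0} ->
         {in Lam, forall l, c l = 0}) &
      (forall f : 'rV[int]_d -> R[i], exists c : 'rV[R]_d -> R[i],
         {in A, forall a, f a = \sum_(l <- Lam) c l * echar l a})].

Definition spectral d (A : seq 'rV[int]_d) : Prop :=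
  exists Lam : seq 'rV[R]_d,
    [/\ uniq Lam, all (@in_torus d) Lam & orth_basis_exps A Lam].

End Defs.

Definition tiles d (A : seq 'rV[int]_d) : Prop :=
  exists T : 'rV[int]_d -> Prop,
    forall x : 'rV[int]_d, exists! t, T t /\ (x - t) \in A.

(* Main.v *)
(* Let |A| = n, and let h be the matrix of the characters of the spectrum on A:
   a complex Hadamard matrix of order n. If some ratio chi of two of these
   characters maps A bijectively onto a coset of the n-th roots of unity, then
   the points t whose chi t lies in a transversal of z |-> z^n form a tiling
   complement of A. For n = 2, 3 this holds because n unimodular numbers with
   vanishing sum are then the roots of X^n - c. For n = 4 two ratios with values
   +-s on A play the same role.
     For n = 5 one has to find rows i, j with p_ij = sum_k (h_ik / h_jk)^2 = 0.
   Evaluating in two ways the product of the permanents of all 2x2 minors of a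
   3x3 block shows that a row pair and a column pair always define congruent
   5-point configurations on the circle. If no p_ij vanishes, the numbers
   Re (conj p_ij (h_ik / h_jk)^2) are y_ik + y_jk for a matrix y such that every
   2x2 minor has equal diagonal or equal antidiagonal entries, so y is constant
   off a partial permutation matrix. If y is constant, a row of h / h_j lies in
   {+-u, +-b}, which a parity argument excludes. Otherwise h is, up to
   equivalence, d I + S with S symmetric with entries +-1 off the diagonal, and
   counting the signs of the triangles of S gives (d + 1/d)^2 = 9, while
   |d + 1/d| <= 2. *)
Require Import Defs.
From HB Require Import structures.
From mathcomp Require Import all_boot all_order all_algebra.
From mathcomp Require Import reals trigo.
From mathcomp Require Import complex.
From mathcomp Require Import ring zify.
Set Implicit Arguments. Unset Strict Implicit. Unset Printing Implicit Defensive.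
Import Order.TTheory GRing.Theory Num.Theory.
Local Open Scope ring_scope.

(** * Vanishing sums of five numbers *)

Section BlockIdentity.
Variable F : fieldType.
Implicit Types a b x y : F.

Lemma vanishing5_inv a b x y z : a != 0 -> b != 0 -> x != 0 -> y != 0 -> z != 0 ->
  a^-1 + b^-1 + x^-1 + y^-1 + z^-1 = 0 ->
  a * b * (x * y + y * z + z * x) + (a + b) * (x * y * z) = 0.
Proof.
move=> a0 b0 x0 y0 z0 h.
have -> : a * b * (x * y + y * z + z * x) + (a + b) * (x * y * z) =
  a * b * x * y * z * (a^-1 + b^-1 + x^-1 + y^-1 + z^-1).
  by field; rewrite a0 b0 x0 y0 z0.
by rewrite h mulr0.
Qed.

(** In the elementary symmetric functions of [x, y, z], [(x + y) * (y + z) * (z + x) = e1 * e2 -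
    e3]. The hypotheses give [e1 = - (a + b)] and [a * b * e2 = - (a + b) * e3]. *)
Lemma vanishing5_triangle a b x y z :
  a != 0 -> b != 0 -> x != 0 -> y != 0 -> z != 0 ->
  a + b + x + y + z = 0 -> a^-1 + b^-1 + x^-1 + y^-1 + z^-1 = 0 ->
  (x + y) * (y + z) * (z + x) * (a * b) = (a ^+ 2 + a * b + b ^+ 2) * (x * y * z).
Proof.
move=> a0 b0 x0 y0 z0 h /(vanishing5_inv a0 b0 x0 y0 z0) h'.
apply/eqP; rewrite -subr_eq0; apply/eqP.
have -> : (x + y) * (y + z) * (z + x) * (a * b) - (a ^+ 2 + a * b + b ^+ 2) * (x * y * z)
  = (x + y + z) * (a * b * (x * y + y * z + z * x) + (a + b) * (x * y * z))
    - (a + b) * (x * y * z) * (a + b + x + y + z) by ring.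
by rewrite h h' !mulr0 subr0.
Qed.

(** The previous identity for the ratios [a / a'], ..., [z / z'] of two rows, cleared of
    denominators. The factors [x * y' + y * x'] are permanents of 2x2 minors. *)
Lemma vanishing5_minors (a b x y z a' b' x' y' z' : F) :
  a != 0 -> b != 0 -> x != 0 -> y != 0 -> z != 0 ->
  a' != 0 -> b' != 0 -> x' != 0 -> y' != 0 -> z' != 0 ->
  a / a' + b / b' + x / x' + y / y' + z / z' = 0 ->
  a' / a + b' / b + x' / x + y' / y + z' / z = 0 ->
  (x * y' + y * x') * (y * z' + z * y') * (z * x' + x * z') * (a * b * a' * b') =
  ((a * b') ^+ 2 + a * b' * b * a' + (b * a') ^+ 2) * (x * y * z * x' * y' * z').
Proof.
move=> a0 b0 x0 y0 z0 a'0 b'0 x'0 y'0 z'0 h h'.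
have := @vanishing5_triangle (a / a') (b / b') (x / x') (y / y') (z / z').
rewrite !mulf_neq0 ?invr_eq0 // !invf_div => /(_ isT isT isT isT isT h h') e.
have -> : (x * y' + y * x') * (y * z' + z * y') * (z * x' + x * z') * (a * b * a' * b') =
  (x / x' + y / y') * (y / y' + z / z') * (z / z' + x / x') * (a / a' * (b / b')) *
  (x' * y' * z' * a' * b') ^+ 2.
  by field; rewrite a'0 b'0 x'0 y'0 z'0.
rewrite e; field; by rewrite a'0 b'0 x'0 y'0 z'0.
Qed.

(* With e1, e2, e3 the elementary symmetric functions of x, y, z, one has
   (x^2+xy+y^2)(y^2+yz+z^2)(z^2+zx+x^2) = e1^2 e2^2 - e1^3 e3 - e2^3, and here
   e1 = -(1+a) and e2 = e1 e3 / a, so everything is a function of e3. *)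
Lemma triple_product a x y z : a != 0 -> x != 0 -> y != 0 -> z != 0 ->
  1 + a + x + y + z = 0 -> 1 + a^-1 + x^-1 + y^-1 + z^-1 = 0 ->
  (x ^+ 2 + x * y + y ^+ 2) * (y ^+ 2 + y * z + z ^+ 2) * (z ^+ 2 + z * x + x ^+ 2)
    * a ^+ 3 =
  (1 + a) ^+ 4 * a * (x * y * z) ^+ 2
    + (1 + a) ^+ 3 * (x * y * z) * (a ^+ 3 + (x * y * z) ^+ 2).
Proof.
move=> a0 x0 y0 z0 h h'.
have := vanishing5_inv (oner_neq0 F) a0 x0 y0 z0; rewrite invr1 => /(_ h') e2.
have e1 : x + y + z = - (1 + a) by apply/eqP; rewrite -subr_eq0 -h; apply/eqP; ring.
have {}e2 : a * (x * y + y * z + z * x) = - ((1 + a) * (x * y * z)).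
  by apply/eqP; rewrite -subr_eq0 -e2; apply/eqP; ring.
have -> : (x ^+ 2 + x * y + y ^+ 2) * (y ^+ 2 + y * z + z ^+ 2) * (z ^+ 2 + z * x + x ^+ 2)
    * a ^+ 3 = (x + y + z) ^+ 2 * (a * (x * y + y * z + z * x)) ^+ 2 * a
   - (x + y + z) ^+ 3 * (x * y * z) * a ^+ 3 - (a * (x * y + y * z + z * x)) ^+ 3 by ring.
rewrite e1 e2; ring.
Qed.

(** With [f = x * y * z] and [k = u * v * w], [triple_product] makes both sides functions of
    [a, f, k], and their difference factors as [(1 + a)^3 * f * k * (k - f) * (f * k - a^3)]. *)
Lemma triple_products_eq a x y z u v w :
  a != 0 -> x != 0 -> y != 0 -> z != 0 -> u != 0 -> v != 0 -> w != 0 ->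
  1 + a + x + y + z = 0 -> 1 + a^-1 + x^-1 + y^-1 + z^-1 = 0 ->
  1 + a + u + v + w = 0 -> 1 + a^-1 + u^-1 + v^-1 + w^-1 = 0 ->
  (u ^+ 2 + u * v + v ^+ 2) * (v ^+ 2 + v * w + w ^+ 2) * (w ^+ 2 + w * u + u ^+ 2)
    * (x * y * z) ^+ 2 =
  (x ^+ 2 + x * y + y ^+ 2) * (y ^+ 2 + y * z + z ^+ 2) * (z ^+ 2 + z * x + x ^+ 2)
    * (u * v * w) ^+ 2 ->
  [\/ 1 + a = 0, x * y * z = u * v * w | (x * y * z) * (u * v * w) = a ^+ 3].
Proof.
move=> a0 x0 y0 z0 u0 v0 w0 h1 h1' h2 h2' /(congr1 (fun t => t * a ^+ 3)).
have H1 := triple_product a0 x0 y0 z0 h1 h1'.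
have H2 := triple_product a0 u0 v0 w0 h2 h2'.
rewrite mulrAC H2 [RHS]mulrAC H1.
have : x * y * z != 0 by rewrite !mulf_neq0.
have : u * v * w != 0 by rewrite !mulf_neq0.
move: (x * y * z) (u * v * w) => f k k0 f0 e.
have : (1 + a) ^+ 3 * (f * k * ((k - f) * (f * k - a ^+ 3))) = 0.
  have -> : (1 + a) ^+ 3 * (f * k * ((k - f) * (f * k - a ^+ 3))) =
  ((1 + a) ^+ 4 * a * k ^+ 2 + (1 + a) ^+ 3 * k * (a ^+ 3 + k ^+ 2)) * f ^+ 2 -
  ((1 + a) ^+ 4 * a * f ^+ 2 + (1 + a) ^+ 3 * f * (a ^+ 3 + f ^+ 2)) * k ^+ 2 by ring.
  by rewrite e subrr.
move/eqP; rewrite mulf_eq0 expf_eq0 /= (mulf_eq0 (f * k)) (mulf_eq0 (k - f)).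
rewrite mulf_eq0 (negPf f0) (negPf k0) /= !subr_eq0.
by case/or3P => /eqP; [constructor 1|constructor 2|constructor 3].
Qed.

Lemma sum_squares a x y z : a != 0 -> x != 0 -> y != 0 -> z != 0 ->
  1 + a + x + y + z = 0 -> 1 + a^-1 + x^-1 + y^-1 + z^-1 = 0 ->
  (1 + a ^+ 2 + x ^+ 2 + y ^+ 2 + z ^+ 2 =
    1 + a ^+ 2 + (1 + a) ^+ 2 + 2 * (1 + a) / a * (x * y * z)).
Proof.
move=> a0 x0 y0 z0 h h'.
have := vanishing5_inv (oner_neq0 F) a0 x0 y0 z0; rewrite invr1 => /(_ h') e2.
have e1 : x + y + z = - (1 + a) by apply/eqP; rewrite -subr_eq0 -h; apply/eqP; ring.
have {}e2 : a * (x * y + y * z + z * x) = - ((1 + a) * (x * y * z)).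
  by apply/eqP; rewrite -subr_eq0 -e2; apply/eqP; ring.
have -> : 1 + a ^+ 2 + x ^+ 2 + y ^+ 2 + z ^+ 2 =
  1 + a ^+ 2 + (x + y + z) ^+ 2 - 2 / a * (a * (x * y + y * z + z * x)) by field.
by rewrite e1 e2; field.
Qed.

(** By [sum_squares] both power sums are the same affine function of the triple product. When the
    triple products multiply to [a^3], the second configuration has to be reflected by [t -> a / t],
    which exchanges 1 and [a]; this is the second alternative. *)
Lemma block_normalized a x y z u v w :
  a != 0 -> x != 0 -> y != 0 -> z != 0 -> u != 0 -> v != 0 -> w != 0 ->
  1 + a + x + y + z = 0 -> 1 + a^-1 + x^-1 + y^-1 + z^-1 = 0 ->
  1 + a + u + v + w = 0 -> 1 + a^-1 + u^-1 + v^-1 + w^-1 = 0 ->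
  (u ^+ 2 + u * v + v ^+ 2) * (v ^+ 2 + v * w + w ^+ 2) * (w ^+ 2 + w * u + u ^+ 2)
    * (x * y * z) ^+ 2 =
  (x ^+ 2 + x * y + y ^+ 2) * (y ^+ 2 + y * z + z ^+ 2) * (z ^+ 2 + z * x + x ^+ 2)
    * (u * v * w) ^+ 2 ->
  1 + a ^+ 2 + x ^+ 2 + y ^+ 2 + z ^+ 2 = 1 + a ^+ 2 + u ^+ 2 + v ^+ 2 + w ^+ 2 \/
  1 + a ^+ 2 + x ^+ 2 + y ^+ 2 + z ^+ 2 =
    a ^+ 2 * (1 + a^-1 ^+ 2 + u^-1 ^+ 2 + v^-1 ^+ 2 + w^-1 ^+ 2).
Proof.
move=> a0 x0 y0 z0 u0 v0 w0 h1 h1' h2 h2' e.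
have H1 := sum_squares a0 x0 y0 z0 h1 h1'.
have H2 := sum_squares a0 u0 v0 w0 h2 h2'.
have H3 := @sum_squares a^-1 u^-1 v^-1 w^-1.
rewrite !invr_eq0 !invrK in H3; move: (H3 a0 u0 v0 w0 h2' h2) => {}H3.
rewrite H1 H2 H3.
have [s0|->|t] := triple_products_eq a0 x0 y0 z0 u0 v0 w0 h1 h1' h2 h2' e.
- by left; rewrite s0 !(mulr0, mul0r).
- by left.
- right; have -> : x * y * z = a ^+ 3 / (u * v * w).
    by rewrite -t mulfK // !mulf_neq0.
  by field; rewrite a0 u0 v0 w0.
Qed.
End BlockIdentity.

(** * Hadamard matrices of order five *)

Lemma big_ord_uniq n (V : nmodType) (F : 'I_n -> V) (s : seq 'I_n) :
  uniq s -> size s = n -> \sum_k F k = \sum_(k <- s) F k.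
Proof.
move=> us ss; apply: perm_big; apply: uniq_perm => [|//|k].
  exact: index_enum_uniq.
rewrite mem_index_enum; have [||_ ->] := uniq_min_size (s2 := enum 'I_n) us.
- by move=> x _; rewrite mem_enum.
- by rewrite size_enum_ord ss.
- by rewrite mem_enum.
Qed.

Lemma ord_complete n (s : seq 'I_n) : uniq s ->
  exists s', uniq (s ++ s') /\ size (s ++ s') = n.
Proof.
move=> us; exists [seq k <- enum 'I_n | k \notin s].
have u : uniq (s ++ [seq k <- enum 'I_n | k \notin s]).
  rewrite cat_uniq us filter_uniq ?enum_uniq // andbT.
  by apply/hasPn => k; rewrite mem_filter => /andP[].
split=> //; rewrite -[RHS](size_enum_ord n); apply/perm_size/uniq_perm => //.
  exact: enum_uniq.
by move=> k; rewrite mem_cat mem_filter mem_enum andbT orbN.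
Qed.

Lemma big_ord5 (V : nmodType) (F : 'I_5 -> V) (i j k l m : 'I_5) :
  uniq [:: i; j; k; l; m] -> \sum_n F n = F i + F j + F k + F l + F m.
Proof. by move/big_ord_uniq->; rewrite // !big_cons big_nil addr0 !addrA. Qed.

Lemma ord5_complete (i j : 'I_5) : i != j -> exists k l m, uniq [:: i; j; k; l; m].
Proof.
move=> ij; have [|s'] := @ord_complete 5 [:: i; j]; first by rewrite /= inE ij.
case: s' => [|k [|l [|m [|? ?]]]] [u] //= _.
by exists k, l, m.
Qed.

(** * Products of squared rows and columns of a type II matrix *)

Section Type2.
Variable F : fieldType.
Implicit Type h : 'I_5 -> 'I_5 -> F.

Definition transp h : 'I_5 -> 'I_5 -> F := fun i k => h k i.

(* For unimodular entries, inverses are conjugates and this says that h is a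
   complex Hadamard matrix. *)
Definition type2 h :=
  [/\ forall i k, h i k != 0,
      forall i j, i != j -> \sum_k h i k / h j k = 0 &
      forall k l, k != l -> \sum_i h i k / h i l = 0].

(** The numbers p_ij of the opening comment; for unimodular [h], Hermitian products of the rows of
    squared entries. *)
Definition sqdot h i j := \sum_k (h i k / h j k) ^+ 2.

Lemma type2_transp h : type2 h -> type2 (transp h).
Proof. by case=> h1 h2 h3; split=> [i k|i j|k l]; [exact: h1|exact: h3|exact: h2]. Qed.

Lemma type2_minors h i j a b x y z : type2 h -> i != j ->
  uniq [:: a; b; x; y; z] ->
  (h i x * h j y + h i y * h j x) * (h i y * h j z + h i z * h j y) *
  (h i z * h j x + h i x * h j z) * (h i a * h i b * h j a * h j b) =
  ((h i a * h j b) ^+ 2 + h i a * h j b * h i b * h j a + (h i b * h j a) ^+ 2) *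
  (h i x * h i y * h i z * h j x * h j y * h j z).
Proof.
case=> h0 row _ ij u; apply: vanishing5_minors => //.
  by rewrite -(row _ _ ij) (big_ord5 _ u).
by rewrite eq_sym in ij; rewrite -(row _ _ ij) (big_ord5 _ u).
Qed.

Lemma mulr_eq3 (a1 a2 a3 b1 b2 b3 : F) :
  a1 = b1 -> a2 = b2 -> a3 = b3 -> a1 * a2 * a3 = b1 * b2 * b3.
Proof. by move=> -> -> ->. Qed.

(* The product of the nine permanents of the 2x2 minors of the block
   {i2,i3,i4} x {k2,k3,k4} is computed row pair by row pair and column pair
   by column pair. *)
Lemma type2_double_product h i0 i1 i2 i3 i4 k0 k1 k2 k3 k4 : type2 h ->
  uniq [:: i0; i1; i2; i3; i4] -> uniq [:: k0; k1; k2; k3; k4] ->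
  let Q i j k l := (h i k * h j l) ^+ 2 + h i k * h j l * h i l * h j k
                   + (h i l * h j k) ^+ 2 in
  Q i2 i3 k0 k1 * Q i3 i4 k0 k1 * Q i4 i2 k0 k1
    * (h i0 k2 * h i1 k2 * (h i0 k3 * h i1 k3) * (h i0 k4 * h i1 k4)) ^+ 2 =
  Q i0 i1 k2 k3 * Q i0 i1 k3 k4 * Q i0 i1 k4 k2
    * (h i2 k0 * h i2 k1 * (h i3 k0 * h i3 k1) * (h i4 k0 * h i4 k1)) ^+ 2.
Proof.
move=> th ui uk Q; have tt := type2_transp th; have h0 : forall i k, h i k != 0 by case: th.
have /= := ui; rewrite !inE !negb_or.
case/and5P=> _ _ /andP[i23 i24] i34 _; rewrite eq_sym in i24.
have /= := uk; rewrite !inE !negb_or.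
case/and5P=> _ _ /andP[k23 k24] k34 _; rewrite eq_sym in k24.
have E1 := mulr_eq3 (type2_minors th i23 uk) (type2_minors th i34 uk) (type2_minors th i24 uk).
have E2 := mulr_eq3 (type2_minors tt k23 ui) (type2_minors tt k34 ui) (type2_minors tt k24 ui).
rewrite /transp in E2.
pose T := h i2 k2 * h i2 k3 * h i2 k4 * (h i3 k2 * h i3 k3 * h i3 k4) * (h i4 k2 * h i4 k3 * h i4 k4).
pose M i j k l := h i k * h j l + h i l * h j k.
pose D := M i2 i3 k2 k3 * M i2 i3 k3 k4 * M i2 i3 k4 k2 *
  (M i3 i4 k2 k3 * M i3 i4 k3 k4 * M i3 i4 k4 k2) *
  (M i4 i2 k2 k3 * M i4 i2 k3 k4 * M i4 i2 k4 k2).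
pose U := h i2 k0 * h i2 k1 * (h i3 k0 * h i3 k1) * (h i4 k0 * h i4 k1).
pose X := h i0 k2 * h i1 k2 * (h i0 k3 * h i1 k3) * (h i0 k4 * h i1 k4).
have {}E1 : D * U ^+ 2 = Q i2 i3 k0 k1 * Q i3 i4 k0 k1 * Q i4 i2 k0 k1 * T ^+ 2.
  rewrite /D /M /Q /U /T; etransitivity; last (etransitivity; first exact: E1); ring.
have {}E2 : D * X ^+ 2 = Q i0 i1 k2 k3 * Q i0 i1 k3 k4 * Q i0 i1 k4 k2 * T ^+ 2.
  rewrite /D /M /Q /X /T; etransitivity; last (etransitivity; first exact: E2); ring.
have T0 : T ^+ 2 != 0 by rewrite expf_neq0 // !mulf_neq0.
apply: (mulIf T0); rewrite -/U -/X mulrAC -E1 [RHS]mulrAC -E2; ring.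
Qed.

(** Normalised at [(i0, k0)], the ratio of the two rows and the ratio of the two columns are
    five-tuples sharing the entries 1 and [a], where [a] is the cross-ratio of the 2x2 minor. Then
    [block_normalized] compares their power sums. *)
Lemma type2_sqdot_block h i0 i1 k0 k1 : type2 h -> i0 != i1 -> k0 != k1 ->
  sqdot h i1 i0 * h i0 k1 ^+ 2 = sqdot (transp h) k1 k0 * h i1 k0 ^+ 2 \/
  sqdot h i1 i0 * h i0 k0 ^+ 2 = sqdot (transp h) k0 k1 * h i1 k1 ^+ 2.
Proof.
move=> th ni nk; have [h0 row col] := th.
have [i2 [i3 [i4 ui]]] := ord5_complete ni.
have [k2 [k3 [k4 uk]]] := ord5_complete nk.
have dp := type2_double_product th ui uk.
rewrite /= in dp.
have r1 := row _ _ ni; rewrite (big_ord5 _ uk) in r1.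
rewrite eq_sym in ni; have r2 := row _ _ ni; rewrite (big_ord5 _ uk) in r2.
have c1 := col _ _ nk; rewrite (big_ord5 _ ui) in c1.
rewrite eq_sym in nk; have c2 := col _ _ nk; rewrite (big_ord5 _ ui) in c2.
have -> : sqdot h i1 i0 = _ := big_ord5 _ uk.
have -> : sqdot (transp h) k1 k0 = _ := big_ord5 _ ui.
have -> : sqdot (transp h) k0 k1 = _ := big_ord5 _ ui.
rewrite /transp.
clear ui uk row col th ni nk.
move: r1 r2 c1 c2 dp.
move: (h i0 k0) (h i0 k1) (h i0 k2) (h i0 k3) (h i0 k4) (h0 i0 k0) (h0 i0 k1) (h0 i0 k2) (h0 i0 k3) (h0 i0 k4).
move: (h i1 k0) (h i1 k1) (h i1 k2) (h i1 k3) (h i1 k4) (h0 i1 k0) (h0 i1 k1) (h0 i1 k2) (h0 i1 k3) (h0 i1 k4).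
move: (h i2 k0) (h i2 k1) (h i3 k0) (h i3 k1) (h i4 k0) (h i4 k1) (h0 i2 k0) (h0 i2 k1) (h0 i3 k0) (h0 i3 k1) (h0 i4 k0) (h0 i4 k1).
move=> c20 c21 c30 c31 c40 c41 n20 n21 n30 n31 n40 n41.
move=> c10 c11 c12 c13 c14 n10 n11 n12 n13 n14.
move=> c00 c01 c02 c03 c04 n00 n01 n02 n03 n04 r1 r2 s1 s2 dp.
have nz := (n00, n01, n02, n03, n04, n10, n11, n12, n13, n14, (n20, n21, n30, n31, n40, n41)).
have := @block_normalized F (c11 * c00 / (c01 * c10))
 (c12 * c00 / (c02 * c10)) (c13 * c00 / (c03 * c10)) (c14 * c00 / (c04 * c10))
 (c21 * c00 / (c01 * c20)) (c31 * c00 / (c01 * c30)) (c41 * c00 / (c01 * c40)).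
rewrite !(mulf_eq0, invr_eq0, negb_or) !nz /= => /(_ isT isT isT isT isT isT isT).
move=> /(_ _ _ _ _ _)[|||||e|e].
- have -> : 0 = c00 / c10 * (c10 / c00 + c11 / c01 + c12 / c02 + c13 / c03 + c14 / c04).
    by rewrite r2 mulr0.
  by field; rewrite !nz.
- have -> : 0 = c10 / c00 * (c00 / c10 + c01 / c11 + c02 / c12 + c03 / c13 + c04 / c14).
    by rewrite r1 mulr0.
  by field; rewrite !nz.
- have -> : 0 = c00 / c01 * (c01 / c00 + c11 / c10 + c21 / c20 + c31 / c30 + c41 / c40).
    by rewrite s2 mulr0.
  by field; rewrite !nz.
- have -> : 0 = c01 / c00 * (c00 / c01 + c10 / c11 + c20 / c21 + c30 / c31 + c40 / c41).
    by rewrite s1 mulr0.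
  by field; rewrite !nz.
(* The monomial [K] turns the identity between entries into the one between normalised ratios. *)
- pose K := c00 ^+ 12 / ((c20 * c30 * c40) ^+ 4 * c01 ^+ 6 * (c02 * c03 * c04) ^+ 4 * c10 ^+ 6).
  move/(congr1 (fun t => t * K)): dp; rewrite /K => dp.
  etransitivity; [|etransitivity; [exact: dp|]]; field; by rewrite !nz.
- left; have {e} := congr1 (fun t => t * (c10 ^+ 2 * c01 ^+ 2 / c00 ^+ 2)) e => e.
  etransitivity; [|etransitivity; [exact: e|]]; field; by rewrite !nz.
- right; have {e} := congr1 (fun t => t * c10 ^+ 2) e => e.
  etransitivity; [|etransitivity; [exact: e|]]; field; by rewrite !nz.
Qed.
End Type2.

(** * Matrices with crossed 2x2 minors *)

Section Crossed.
Variable T : eqType.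
Implicit Types (a b : 'I_5 -> T) (v : T).

Definition almost_const a v := forall k l, k != l -> a k = v \/ a l = v.

(** Among three indices at least two carry [v] and at least two carry [v'], so one carries both. *)
Lemma almost_const_inj a v v' : almost_const a v -> almost_const a v' -> v = v'.
Proof.
pose o n (ltn5 : (n < 5)%N) := Ordinal ltn5.
move=> av av'.
have := av (o 0 isT) (o 1 isT) isT; have := av (o 0 isT) (o 2 isT) isT.
have := av (o 1 isT) (o 2 isT) isT; have := av' (o 0 isT) (o 1 isT) isT.
have := av' (o 0 isT) (o 2 isT) isT; have := av' (o 1 isT) (o 2 isT) isT.
by do 6!case=> ?; congruence.
Qed.

Lemma crossed_rows a b : (forall k l, k != l -> a k = b l \/ a l = b k) ->
  exists v, [/\ forall k, a k = v \/ b k = v, almost_const a v & almost_const b v].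
Proof.
move=> ab; pose o n (ltn5 : (n < 5)%N) := Ordinal ltn5.
(* Read [a k = b l] as an arrow from [k] to [l]. A tournament on four vertices contains a transitive
   triple [m -> k], [m -> l], [k -> l], and there [a k = b l = a m = b k]. *)
have [k akv] : exists k, a k = b k.
  case: (eqVneq (a (o 0 isT)) (b (o 0 isT))) => [?|/eqP n0]; first by exists (o 0 isT).
  case: (eqVneq (a (o 1 isT)) (b (o 1 isT))) => [?|/eqP n1]; first by exists (o 1 isT).
  case: (eqVneq (a (o 2 isT)) (b (o 2 isT))) => [?|/eqP n2]; first by exists (o 2 isT).
  case: (eqVneq (a (o 3 isT)) (b (o 3 isT))) => [?|/eqP n3]; first by exists (o 3 isT).
  exfalso.
  have := ab (o 0 isT) (o 1 isT) isT; have := ab (o 0 isT) (o 2 isT) isT.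
  have := ab (o 0 isT) (o 3 isT) isT; have := ab (o 1 isT) (o 2 isT) isT.
  have := ab (o 1 isT) (o 3 isT) isT; have := ab (o 2 isT) (o 3 isT) isT.
  by do 6!case=> ?; congruence.
have cover l : a l = a k \/ b l = a k.
  by case: (eqVneq k l) => [->|/ab]; [left|rewrite -akv; case; [right|left]].
(* If [a] missed the common value at both [l] and [m], then [b] would take it at both by [cover],
   against the crossing of [l] and [m]. *)
exists (a k); split=> // l m lm.
- by case: (cover l) (cover m) (ab _ _ lm) => [?|?] [?|?] [?|?];
    first [left; congruence|right; congruence].
- by case: (cover l) (cover m) (ab _ _ lm) => [?|?] [?|?] [?|?];
    first [left; congruence|right; congruence].
Qed.

(* That is, y is constant off a partial permutation matrix. *)
Lemma crossed_matrix (y : 'I_5 -> 'I_5 -> T) :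
  (forall i j k l, i != j -> k != l -> y i k = y j l \/ y i l = y j k) ->
  exists v, (forall i j k, i != j -> y i k = v \/ y j k = v) /\
            (forall i, almost_const (y i) v).
Proof.
move=> cr; pose o n (ltn5 : (n < 5)%N) := Ordinal ltn5.
have pair i j : i != j -> exists v,
    [/\ forall k, y i k = v \/ y j k = v, almost_const (y i) v & almost_const (y j) v].
  by move=> ij; apply: crossed_rows => k l; apply: cr.
have [v [_ v0 v1]] := pair (o 0 isT) (o 1 isT) isT.
exists v.
have ac i : almost_const (y i) v.
  case: (eqVneq (o 0 isT) i) => [<-//|/pair[w [_ w0 wi]]].
  by rewrite (almost_const_inj v0 w0).
split=> // i j k /pair[w [wk wi _]].
by rewrite (almost_const_inj (ac i) wi).
Qed.
End Crossed.

(** * Pair functions that are additive over the rows and columns of one matrix *)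

Section Additive.
Variable F : numFieldType.
Variables (W V : 'I_5 -> 'I_5 -> 'I_5 -> F) (M : F).
Hypothesis sumW : forall i j, i != j -> \sum_k W i j k = M *+ 2.
Hypothesis sumV : forall k l, k != l -> \sum_i V k l i = M *+ 2.
Hypothesis WV : forall i j k l, i != j -> k != l ->
  W i j k + W i j l = V k l i + V k l j.

Let sumD1 (f : 'I_5 -> F) k : \sum_(l | l != k) f l = \sum_l f l - f k.
Proof. by rewrite [in RHS](bigD1 k) //= addrAC subrr add0r. Qed.

Let sum_const (c : F) k : \sum_(l < 5 | l != k) c = c *+ 4.
Proof.
rewrite sumr_const; congr (_ *+ _).
by rewrite (eq_card (B := predC1 k)) // cardC1 card_ord.
Qed.

Let nz3 : 3 != 0 :> F. Proof. by rewrite pnatr_eq0. Qed.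

Lemma additive_matrix : exists y : 'I_5 -> 'I_5 -> F,
  [/\ forall i j k, i != j -> W i j k = y i k + y j k,
      forall k l i, k != l -> V k l i = y i k + y i l &
      forall i, \sum_k y i k = M].
Proof.
(* Summing [WV] over [l != k] gives [3 * W i j k + 2 * M] as a term in [(i, k)] plus the same term
   in [(j, k)]; this dictates [y]. *)
pose y i k := (\sum_(l | l != k) V k l i - M) / 3.
have Wy i j k : i != j -> W i j k = y i k + y j k.
  move=> ij; have: \sum_(l | l != k) (W i j k + W i j l) =
                   \sum_(l | l != k) (V k l i + V k l j).
    by apply: eq_bigr => l lk; apply: WV; rewrite // eq_sym.
  rewrite !big_split /= sum_const sumD1 sumW // /y => e.
  rewrite -mulrDl addrACA -e; by field.
have colsum k : \sum_j y j k = M.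
  have e : \sum_j \sum_(l | l != k) V k l j = M *+ 2 *+ 4.
    rewrite exchange_big /= -(sum_const _ k).
    by apply: eq_bigr => l lk; apply: sumV; rewrite eq_sym.
  have -> : \sum_j y j k = (\sum_j (\sum_(l | l != k) V k l j - M)) / 3 by rewrite mulr_suml.
  by rewrite sumrB e sumr_const card_ord; field.
have Vy k l i : k != l -> V k l i = y i k + y i l.
  move=> kl; have: \sum_(j | j != i) (W i j k + W i j l) =
                   \sum_(j | j != i) (V k l i + V k l j).
    by apply: eq_bigr => j ji; apply: WV; rewrite // eq_sym.
  rewrite [RHS]big_split /= [in RHS]sum_const [in RHS]sumD1 sumV //.
  under eq_bigr => j ji do rewrite !Wy 1?eq_sym //.
  rewrite !big_split /= !sum_const !sumD1 !colsum => e.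
  apply: (mulfI nz3); apply/eqP; rewrite -subr_eq0; apply/eqP.
  transitivity (V k l i *+ 4 + (M *+ 2 - V k l i) -
    (y i k *+ 4 + (M - y i k) + (y i l *+ 4 + (M - y i l)))); first by ring.
  by rewrite -e subrr.
exists y; split=> // i.
(* Three row sums whose pairwise sums are all [2 * M] are each equal to [M]. *)
have two_sum i1 i2 : i1 != i2 -> \sum_k y i1 k + \sum_k y i2 k = M *+ 2.
  by move=> ne; rewrite -big_split /= -(sumW ne); apply: eq_bigr => k _; rewrite Wy.
have [j ij] : exists j, i != j.
  by case: (eqVneq i ord0) => [->|]; [exists ord_max|exists ord0].
have [l [m [n]]] := ord5_complete ij.
rewrite /= !inE !negb_or => /and5P[/and4P[_ il _ _] /and3P[jl _ _] _ _ _].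
have e1 := two_sum _ _ ij; have e2 := two_sum _ _ il; have e3 := two_sum _ _ jl.
have nz2 : 2 != 0 :> F by rewrite pnatr_eq0.
apply: (mulfI nz2).
transitivity ((\sum_k y i k + \sum_k y j k) + (\sum_k y i k + \sum_k y l k)
  - (\sum_k y j k + \sum_k y l k)); first by ring.
by rewrite e1 e2 e3; ring.
Qed.
End Additive.

(** * Hadamard matrices of order five: exclusion of the degenerate cases *)

(** The map [t -> p / t + q * t] is two-to-one: its fibres are [{x, p / (q * x)}]. *)
Lemma inv_add_eq (F : fieldType) (p q x y : F) : x != 0 -> y != 0 ->
  p / x + q * x = p / y + q * y -> x = y \/ q * (x * y) = p.
Proof.
move=> x0 y0 e; have : (x - y) * (q * (x * y) - p) = 0.
  have -> : (x - y) * (q * (x * y) - p) = x * y * ((p / x + q * x) - (p / y + q * y)).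
    by field; rewrite x0 y0.
  by rewrite e subrr mulr0.
by move/eqP; rewrite mulf_eq0 !subr_eq0 => /orP[] /eqP; [left|right].
Qed.

Section Unimodular.
Variable C : numClosedFieldType.

(* Each x k is one of +-x 0, +-b with |b| = 1, so the sum is A x0 + B b with
   A + B odd; it cannot vanish, since that forces |A| = |B|. *)
Lemma sum5_neq0 (x : 'I_5 -> C) (p q c : C) : (forall k, `|x k| = 1) ->
  q != 0 -> `|p| = `|q| -> (forall k, p / x k ^+ 2 + q * x k ^+ 2 = c) ->
  \sum_k x k != 0.
Proof.
move=> xu q0 pq xc; have x0 k : x k != 0 by rewrite -normr_gt0 xu.
(* Besides [u^2], the only value allowed for [x k ^ 2] is [p / (q * u^2)]; [b] is a square root of
   it. *)
pose u := x ord0; pose b := sqrtC (p / (q * u ^+ 2)).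
have bu : `|b| = 1.
  apply/eqP; rewrite -sqrp_eq1 // -normrX sqrtCK normf_div normrM normrX xu pq.
  by rewrite expr1n mulr1 divff // normr_eq0.
have dec k : exists mn : int * int,
    x k = mn.1%:~R * u + mn.2%:~R * b /\ exists r, mn.1 + mn.2 = r * 2 + 1.
  have e : p / x k ^+ 2 + q * x k ^+ 2 = p / u ^+ 2 + q * u ^+ 2 by rewrite !xc.
  have [/eqP|e'] := inv_add_eq (expf_neq0 2 (x0 k)) (expf_neq0 2 (x0 ord0)) e.
    rewrite eqf_sqr => /orP[] /eqP ->; [exists (1, 0)|exists (-1, 0)] => /=.
      by split; [rewrite -?/u ?mulrN1z ?mulr1z ?mulr0z; ring|exists 0].
    by split; [rewrite -?/u ?mulrN1z ?mulr1z ?mulr0z; ring|exists (-1)].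
  have /eqP : x k ^+ 2 = b ^+ 2.
    by rewrite sqrtCK -e' mulrCA mulfK // mulf_neq0 ?expf_neq0.
  rewrite eqf_sqr => /orP[] /eqP ->; [exists (0, 1)|exists (0, -1)] => /=.
    by split; [rewrite -?/u ?mulrN1z ?mulr1z ?mulr0z; ring|exists 0].
  by split; [rewrite -?/u ?mulrN1z ?mulr1z ?mulr0z; ring|exists (-1)].
have : exists A B r : int, \sum_k x k = A%:~R * u + B%:~R * b /\ A + B = r * 2 + 1.
  pose o n (ltn5 : (n < 5)%N) := Ordinal ltn5.
  rewrite (big_ord5 _ (i := o 0 isT) (j := o 1 isT) (k := o 2 isT) (l := o 3 isT) (m := o 4 isT)) //.
  have [mn0 [-> [r0 e0]]] := dec (o 0 isT).
  have [mn1 [-> [r1 e1]]] := dec (o 1 isT).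
  have [mn2 [-> [r2 e2]]] := dec (o 2 isT).
  have [mn3 [-> [r3 e3]]] := dec (o 3 isT).
  have [mn4 [-> [r4 e4]]] := dec (o 4 isT).
  (* Five odd numbers [2 * r + 1] add up to twice the sum of the [r], plus 5, whence the extra 2. *)
  exists (mn0.1 + mn1.1 + mn2.1 + mn3.1 + mn4.1), (mn0.2 + mn1.2 + mn2.2 + mn3.2 + mn4.2),
    (r0 + r1 + r2 + r3 + r4 + 2).
  by split; [ring|lia].
case=> A [B [r [-> AB]]]; apply/eqP => /eqP.
rewrite addr_eq0 => /eqP /(congr1 (fun z => `|z|)).
rewrite normrN !normrM xu bu !mulr1 -!intr_norm => /eqP.
rewrite eqr_int => /eqP; lia.
Qed.

(** Orthogonality first makes the signs symmetric. It then says, for each edge [ij], that [d + 1/d]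
    plus the signs of the three triangles on [ij] vanishes; these ten equations determine the sign
    of each triangle in terms of [d + 1/d]. *)
Lemma sign_matrix_false (s : 'I_5 -> 'I_5 -> C) (d : C) : `|d| = 1 ->
  (forall i, s i i = d) -> (forall i j, i != j -> s i j ^+ 2 = 1) ->
  (forall i j, i != j -> \sum_k s i k / s j k = 0) -> False.
Proof.
move=> du sd s1 orth; have d0 : d != 0 by rewrite -normr_gt0 du.
have sV i j : i != j -> (s i j)^-1 = s i j.
  by move/s1 => e; apply: (mulfI (x := s i j)); rewrite ?divff -?expr2 // -sqrf_eq0 e oner_eq0.
have pm i j : i != j -> s i j = 1 \/ s i j = -1.
  by move/s1/eqP; rewrite sqrf_eq1 => /orP[] /eqP; [left|right].
have row i j k l m : uniq [:: i; j; k; l; m] ->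
   d * s j i + s i j / d + (s i k * s j k + s i l * s j l + s i m * s j m) = 0.
  move=> u; have := u; rewrite /= !inE !negb_or.
  case/and5P=> /and4P[ij _ _ _] /and3P[jk jl jm] _ _ _.
  by rewrite -(orth _ _ ij) (big_ord5 _ u) !sd !sV // 1?eq_sym //; ring.
have sym i j : i != j -> s i j = s j i.
  move=> ij; have [k [l [m u]]] := ord5_complete ij.
  have r1 := row _ _ _ _ _ u.
  have u' : uniq [:: j; i; k; l; m].
    move: u; rewrite /= !inE !negb_or (eq_sym j i).
    by case/and5P=> /and4P[-> -> -> ->] /and3P[-> -> ->] -> ->.
  have r2 := row _ _ _ _ _ u'.
  have ji : j != i by rewrite eq_sym.
  have : (d - d^-1) * (s j i - s i j) = 0.
    transitivity ((d * s j i + s i j / d + (s i k * s j k + s i l * s j l + s i m * s j m))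
     - (d * s i j + s j i / d + (s j k * s i k + s j l * s i l + s j m * s i m))); first by ring.
    by rewrite r1 r2 subrr.
  move/eqP; rewrite mulf_eq0 !subr_eq0 => /orP[/eqP dd|/eqP //].
  (* Here [d = 1/d]. If [s i j] and [s j i] were opposite, the first two terms of [row] would cancel
     and leave three signs with sum zero. *)
  move: u; rewrite /= !inE !negb_or => /and5P[/and4P[_ ik il im] /and3P[jk jl jm] _ _ _].
  have odd3 (a b c : C) : (a = 1 \/ a = -1) -> (b = 1 \/ b = -1) -> (c = 1 \/ c = -1) ->
    a + b + c != 0.
    have n1 : (1 : C) != 0 := oner_neq0 C.
    have n3 : (3 : C) != 0 by rewrite pnatr_eq0.
    case=> ->; case=> ->; case=> ->; apply/eqP => e.
    - by move/eqP: n3; apply; rewrite -[RHS]e; ring.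
    - by move/eqP: n1; apply; rewrite -[RHS]e; ring.
    - by move/eqP: n1; apply; rewrite -[RHS]e; ring.
    - by move/eqP: n1; apply; rewrite -[RHS]oppr0 -[in RHS]e; ring.
    - by move/eqP: n1; apply; rewrite -[RHS]e; ring.
    - by move/eqP: n1; apply; rewrite -[RHS]oppr0 -[in RHS]e; ring.
    - by move/eqP: n1; apply; rewrite -[RHS]oppr0 -[in RHS]e; ring.
    - by move/eqP: n3; apply; rewrite -[RHS]oppr0 -[in RHS]e; ring.
  have pm2 a b : (a = 1 \/ a = -1) -> (b = 1 \/ b = -1) -> (a * b = 1 \/ a * b = -1 :> C).
    by case=> ->; case=> ->; rewrite ?mulrNN ?mulr1 ?mul1r; [left|right|right|left].
  have := odd3 _ _ _ (pm2 _ _ (pm _ _ ik) (pm _ _ jk)) (pm2 _ _ (pm _ _ il) (pm _ _ jl))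
    (pm2 _ _ (pm _ _ im) (pm _ _ jm)).
  case: (pm _ _ ij) (pm _ _ ji) r1 => -> [] -> //; rewrite -dd => r1 /negP[]; apply/eqP.
    by rewrite -[RHS]r1; ring.
  by rewrite -[RHS]r1; ring.
pose e := d + d^-1; pose t i j k := s i j * s i k * s j k.
have tri i j k l m : uniq [:: i; j; k; l; m] -> e + t i j k + t i j l + t i j m = 0.
  move=> u; have := row _ _ _ _ _ u.
  move: u; rewrite /= !inE !negb_or => /and5P[/and4P[ij ik il im] /and3P[jk jl jm] _ _ _].
  rewrite -(sym _ _ ij) => /(congr1 (fun z => s i j * z)); rewrite mulr0 => <-.
  rewrite /t /e; transitivity (s i j ^+ 2 * (d + d^-1) + s i j * s i k * s j k
    + s i j * s i l * s j l + s i j * s i m * s j m); last by ring.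
  by rewrite s1 // mul1r.
have tC12 i j k : i != j -> t i j k = t j i k.
  by move=> ij; rewrite /t (sym _ _ ij); ring.
have tC23 i j k : j != k -> t i j k = t i k j.
  by move=> jk; rewrite /t (sym _ _ jk); ring.
pose o n (ltn5 : (n < 5)%N) := Ordinal ltn5.
pose o0 := o 0 isT; pose o1 := o 1 isT; pose o2 := o 2 isT; pose o3 := o 3 isT; pose o4 := o 4 isT.
have E01 := tri o0 o1 o2 o3 o4 isT.
have E02 := tri o0 o2 o1 o3 o4 isT.
have E12 := tri o1 o2 o0 o3 o4 isT.
have E34 := tri o3 o4 o0 o1 o2 isT.
have E03 := tri o0 o3 o1 o2 o4 isT.
have E04 := tri o0 o4 o1 o2 o3 isT.
have E13 := tri o1 o3 o0 o2 o4 isT.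
have E14 := tri o1 o4 o0 o2 o3 isT.
have E23 := tri o2 o3 o0 o1 o4 isT.
have E24 := tri o2 o4 o0 o1 o3 isT.
(* Edges inside {0,1,2} and the edge 34 get weight 2, the six edges across get weight -1. Every
   triangle other than 012 has one inner and two crossing edges, hence cancels. *)
have te : 6 * t o0 o1 o2 = - (2 * e).
  have : 6 * t o0 o1 o2 + 2 * e = 0.
    transitivity (2 * ((e + t o0 o1 o2 + t o0 o1 o3 + t o0 o1 o4)
     + (e + t o0 o2 o1 + t o0 o2 o3 + t o0 o2 o4)
     + (e + t o1 o2 o0 + t o1 o2 o3 + t o1 o2 o4)
     + (e + t o3 o4 o0 + t o3 o4 o1 + t o3 o4 o2))
     - ((e + t o0 o3 o1 + t o0 o3 o2 + t o0 o3 o4)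
     + (e + t o0 o4 o1 + t o0 o4 o2 + t o0 o4 o3)
     + (e + t o1 o3 o0 + t o1 o3 o2 + t o1 o3 o4)
     + (e + t o1 o4 o0 + t o1 o4 o2 + t o1 o4 o3)
     + (e + t o2 o3 o0 + t o2 o3 o1 + t o2 o3 o4)
     + (e + t o2 o4 o0 + t o2 o4 o1 + t o2 o4 o3))); last first.
      rewrite E01 E02 E12 E34 E03 E04 E13 E14 E23 E24; ring.
    rewrite /t (sym o1 o0) // (sym o2 o0) // (sym o2 o1) // (sym o3 o0) // (sym o3 o1) //
      (sym o3 o2) // (sym o4 o0) // (sym o4 o1) // (sym o4 o2) // (sym o4 o3) //; ring.
  by move/eqP; rewrite addr_eq0 => /eqP.
have e9 : e ^+ 2 = 9.
  have t1 : t o0 o1 o2 ^+ 2 = 1 by rewrite /t !exprMn !s1 // !mul1r.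
  apply: (mulfI (x := 4)); first by rewrite pnatr_eq0.
  transitivity ((- (2 * e)) ^+ 2); first by ring.
  by rewrite -te exprMn t1; ring.
have : `|e| <= 2.
  by apply: le_trans (ler_normD _ _) _; rewrite normfV du invr1.
have : `|e| ^+ 2 = 3 ^+ 2 by rewrite -normrX e9 normr_nat; ring.
move/eqP; rewrite eqrXn2 ?normr_ge0 ?ler0n // => /eqP ->.
by rewrite ler_nat.
Qed.
End Unimodular.

(** * The case where [y] is exceptional exactly on the diagonal *)

Section Potts.
Variable C : numClosedFieldType.
Variables (h : 'I_5 -> 'I_5 -> C) (N T V : C) (kap : 'I_5 -> C).
Hypothesis th : type2 h.
Hypothesis hu : forall i k, `|h i k| = 1.
Hypothesis N0 : N != 0.
Hypothesis pN : forall i j, i != j -> sqdot h i j * sqdot h j i = N.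
Hypothesis kapE : forall i j, i != j -> sqdot h i j * h j i ^+ 2 = kap i.
Let g i k := h i k ^+ 2.
Hypothesis diagE : forall i, kap i / g i i + N * g i i / kap i = T.
Hypothesis offE : forall i j k, i != j -> i != k -> j != k ->
  kap i * g j k / (g j i * g i k) + N * (g j i * g i k) / (kap i * g j k) = V.

Let h0 i k : h i k != 0. Proof. by case: th. Qed.
Let g0 i k : g i k != 0. Proof. by rewrite expf_neq0. Qed.

Let kapM i j : i != j -> kap i * kap j = N * (g i j * g j i).
Proof.
move=> ij; rewrite -(kapE ij) -(@kapE j i) 1?eq_sym // -(pN ij) /g; ring.
Qed.

Let kap0 i : kap i != 0.
Proof.
have [j ij] : exists j, i != j.
  by case: (eqVneq i ord0) => [->|]; [exists ord_max|exists ord0].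
have : kap i * kap j != 0 by rewrite kapM // !mulf_neq0.
by rewrite mulf_eq0 negb_or => /andP[].
Qed.

(** In these variables [diagE] and [offE] read [1/t + N * t = T] for [t = D i] and [= V] for
    [t = X i j k], so each takes at most two values, [t] and [1 / (N * t)]. *)
Let D i := g i i / kap i.
Let X i j k := g i k * g j i / (g j k * kap i).

Let D0 i : D i != 0. Proof. by rewrite mulf_neq0 ?invr_eq0. Qed.
Let X0 i j k : X i j k != 0. Proof. by rewrite !mulf_neq0 ?invr_eq0 ?mulf_neq0. Qed.

Let DE i : 1 / D i + N * D i = T.
Proof. by rewrite -(diagE i) /D; field; rewrite kap0 g0. Qed.

Let XE i j k : i != j -> i != k -> j != k -> 1 / X i j k + N * X i j k = V.
Proof.
by move=> ij ik jk; rewrite -(offE ij ik jk) /X; field; rewrite kap0 !g0.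
Qed.

(** This is [kapE] expanded over the columns and divided by [kap i]: column [i] contributes [D i],
    column [j] contributes [1 / (N * D j)] by [kapM]. *)
Let row i j k l m : uniq [:: i; j; k; l; m] ->
  D i + (N * D j)^-1 + (X i j k + X i j l + X i j m) = 1.
Proof.
move=> u; have := u; rewrite /= !inE !negb_or => /and5P[/and4P[ij _ _ _] _ _ _ _].
have e := kapE ij; rewrite /sqdot (big_ord5 _ u) in e.
have -> : (N * D j)^-1 = g i j * g j i / (g j j * kap i).
  have -> : (N * D j)^-1 = kap i * kap j / (N * g j j * kap i).
    by rewrite /D; field; rewrite kap0 N0 g0 kap0.
  by rewrite kapM //; field; rewrite kap0 N0 g0.
apply: (mulfI (kap0 i)); rewrite mulr1 -[RHS]e /D /X /g.
by field; rewrite kap0 !h0.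
Qed.

Let X_swap i j k : i != j -> X j i k = (N * X i j k)^-1.
Proof.
move=> ij; have -> : X j i k = X j i k * kap i * kap j / (kap i * kap j).
  by field; rewrite !kap0.
rewrite [in X in _ / X]kapM // /X; field.
by rewrite !g0 N0 !kap0.
Qed.

(** Three indices and at most two values. *)
Let D_pair : exists i j, i != j /\ D i = D j.
Proof.
pose o n (ltn5 : (n < 5)%N) := Ordinal ltn5.
have Deq i j : D i = D j \/ N * (D i * D j) = 1.
  by apply: inv_add_eq; rewrite // !DE.
have [e|e1] := Deq (o 0 isT) (o 1 isT); first by exists (o 0 isT), (o 1 isT).
have [e|e2] := Deq (o 0 isT) (o 2 isT); first by exists (o 0 isT), (o 2 isT).
exists (o 1 isT), (o 2 isT); split=> //.
have n0 : N * D (o 0 isT) != 0 by rewrite mulf_neq0.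
by apply: (mulfI n0); rewrite -[LHS]mulrA e1 -[RHS]mulrA e2.
Qed.

(* If D i = D j, the equations [row] at (i,j) and at (j,i) show that a sum of
   three numbers from {x, x'}, x x' = 1/N, is invariant under swapping x and
   x'; three being odd, x = x'. *)
Let X_const : exists x, N * x ^+ 2 = 1 /\
  forall i j k, i != j -> i != k -> j != k -> X i j k = x.
Proof.
have [i [j [ij Dij]]] := D_pair.
have [k [l [m u]]] := ord5_complete ij.
have u' : uniq [:: j; i; k; l; m].
  move: u; rewrite /= !inE !negb_or (eq_sym j i).
  by case/and5P=> /and4P[-> -> -> ->] /and3P[-> -> ->] -> ->.
have dd : D i + (N * D j)^-1 = D j + (N * D i)^-1 by congr (_ + (N * _)^-1).
have : X i j k + X i j l + X i j m = X j i k + X j i l + X j i m.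
  by apply: (addrI (D i + (N * D j)^-1)); rewrite (row u) dd (row u').
have -> := X_swap k ij; have -> := X_swap l ij; have -> := X_swap m ij.
move: u; rewrite /= !inE !negb_or => /and5P[/and4P[_ ik il im] /and3P[jk jl jm] _ _ _].
have cmp i1 j1 k1 i2 j2 k2 : i1 != j1 -> i1 != k1 -> j1 != k1 ->
  i2 != j2 -> i2 != k2 -> j2 != k2 ->
  X i1 j1 k1 = X i2 j2 k2 \/ X i1 j1 k1 = (N * X i2 j2 k2)^-1.
  move=> *; have [||//||e] := @inv_add_eq _ 1 N (X i1 j1 k1) (X i2 j2 k2).
  - exact: X0. - exact: X0. - by rewrite !XE. - by left.
  right; have n0 : N * X i2 j2 k2 != 0 by rewrite mulf_neq0.
  by apply: (mulfI n0); rewrite divff // -e; ring.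
move=> e; pose x := X i j k.
have x0 : x != 0 := X0 i j k.
have Nx : N * x ^+ 2 = 1.
  have n3 : 3 != 0 :> C by rewrite pnatr_eq0.
  have Nxx : x = (N * x)^-1 -> N * x ^+ 2 = 1.
    by move=> e'; rewrite expr2 mulrA {2}e' divff // mulf_neq0.
  apply: Nxx.
  have VV : (N * (N * x)^-1)^-1 = x by field; rewrite x0 N0.
  have [el|el] := cmp i j l i j k ij il jl ij ik jk;
  have [em|em] := cmp i j m i j k ij im jm ij ik jk;
  move: e; rewrite el em -/x ?VV => e.
  - by apply: (mulfI n3); transitivity (x + x + x); [ring|rewrite e; ring].
  - apply/eqP; rewrite -subr_eq0; apply/eqP.
    transitivity (x + x + (N * x)^-1 - ((N * x)^-1 + (N * x)^-1 + x)); first by ring.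
    by rewrite e subrr.
  - apply/eqP; rewrite -subr_eq0; apply/eqP.
    transitivity (x + (N * x)^-1 + x - ((N * x)^-1 + x + (N * x)^-1)); first by ring.
    by rewrite e subrr.
  - apply/eqP; rewrite -subr_eq0; apply/eqP.
    transitivity ((N * x)^-1 + x + x - (x + (N * x)^-1 + (N * x)^-1)); first by ring.
    by rewrite -e; ring.
exists x; split=> // i1 j1 k1 n1 n2 n3.
have [//|->] := cmp i1 j1 k1 i j k n1 n2 n3 ij ik jk.
have n0 : N * x != 0 by rewrite mulf_neq0.
by apply: (mulfI n0); rewrite divff // -Nx; ring.
Qed.

(** Once [X] and [D] are constant, the squared entries satisfy [g i j = kk i * b j ^ 2 / b i ^ 2]
    off the diagonal. Rescaling rows and columns accordingly turns [h] into a matrix with constant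
    diagonal and signs elsewhere. *)
Lemma potts_false : False.
Proof.
have [x [Nx Xx]] := X_const.
have nx0 : x != 0.
  by apply/eqP => x0; move/eqP: Nx; rewrite x0 expr0n mulr0 eq_sym oner_eq0.
have Dj i j : i != j -> D i = 1 - x *+ 3 - (N * D j)^-1.
  move=> ij; have [k [l [m u]]] := ord5_complete ij.
  have := row u; move: u; rewrite /= !inE !negb_or.
  case/and5P=> /and4P[_ ik il im] /and3P[jk jl jm] _ _ _.
  by rewrite !Xx // => <-; ring.
(* By [Dj], any two values of [D] are given by the same expression in a third one. *)
have [d dE] : exists d, forall i, D i = d.
  exists (D ord0) => i; have [->//|/ord5_complete] := eqVneq ord0 i.
  case=> [k [l [m]]]; rewrite /= !inE !negb_or.
  case/and5P=> /and4P[_ ok _ _] /and3P[ik _ _] _ _ _.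
  by rewrite (Dj _ _ ok) (Dj _ _ ik).
have d0 : d != 0 by rewrite -(dE ord0).
pose kk i := kap i * x.
have kk0 i : kk i != 0 by rewrite mulf_neq0.
have gii i : g i i = d / x * kk i.
  by rewrite -(dE i) /D /kk; field; rewrite kap0 nx0.
have gij i j : i != j -> g i j * g j i = kk i * kk j.
  by move=> ij; rewrite -[LHS]mul1r -Nx mulrAC -kapM // /kk; ring.
have gijk i j k : i != j -> i != k -> j != k -> g i k * g j i = kk i * g j k.
  move=> ij ik jk; rewrite /kk -(Xx _ _ _ ij ik jk) /X; field.
  by rewrite !g0 kap0.
pose o : 'I_5 := ord0.
(* The column scaling is read off row [o]; at [o] itself the diagonal entry is replaced by a root of
   [kk o], so that [gb] holds there too. *)
pose b j := if j == o then sqrtC (kk o) else h o j.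
have b0 j : b j != 0 by rewrite /b; case: ifP => _; rewrite ?sqrtC_eq0.
have gb i j : i != j -> g i j * b i ^+ 2 = kk i * b j ^+ 2.
  move=> ij; rewrite /b; have [ei|ni] := eqVneq i o; have [ej|nj] := eqVneq j o.
  - by move: ij; rewrite ei ej eqxx.
  - by rewrite sqrtCK ei mulrC.
  - by rewrite sqrtCK -/(g o i) -gij // ej.
  - by rewrite -/(g o i) -/(g o j) -gijk // 1?eq_sym //.
(* By [gii], [del^2] is the common ratio [g i i / kk i]. It is unimodular since [|N| = 1/|d|^2] and
   [N * x^2 = 1] give [|x| = |d|]. *)
pose del := sqrtC (d / x).
have delu : `|del| = 1.
  apply/eqP; rewrite -sqrp_eq1 // -normrX sqrtCK.
  have kapu i : `|kap i| = `|d|^-1.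
    apply: invr_inj; rewrite invrK -(dE i) /D normf_div /g normrX hu expr1n mul1r //.
  have gu i k : `|g i k| = 1 by rewrite /g normrX hu expr1n.
  have eN : `|kap o| * `|kap ord_max| = `|N|.
    by rewrite -normrM kapM // normrM [X in _ * X]normrM !gu !mulr1.
  rewrite !kapu in eN.
  have := congr1 (fun z => `|z|) Nx; rewrite normrM normrX normr1 -eN => e1.
  have ndu : `|d| != 0 by rewrite normr_eq0.
  rewrite normf_div.
  rewrite -sqrp_eq1 ?divr_ge0 // expr_div_n; apply/eqP.
  have nx2 : `|x| ^+ 2 != 0 by rewrite expf_neq0 // normr_eq0.
  apply: (mulIf nx2); rewrite mulfVK // mul1r -[LHS]mulr1 -e1; field; exact: ndu.
have del0 : del != 0 by rewrite -normr_gt0 delu.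
apply: (@sign_matrix_false C (fun i j => del * h i j * b i / (h i i * b j)) del) => //.
- by move=> i; field; rewrite h0 b0.
- move=> i j ij; rewrite !(exprMn, exprVn) sqrtCK -!/(g _ _) gii.
  rewrite -(mulrA _ (g i j)) gb //; field.
  by rewrite nx0 b0 kk0.
- move=> i j ij.
  have [_ r _] := th.
  transitivity (b i / h i i / (b j / h j j) * \sum_k h i k / h j k).
    by rewrite mulr_sumr; apply: eq_bigr => k _; field; rewrite !h0 !b0 del0.
  by rewrite r // mulr0.
Qed.
End Potts.

(** * Orthogonality of the squared rows *)

Section Hadamard5.
Variable C : numClosedFieldType.

Lemma unitary_conj (z : C) : `|z| = 1 -> z^* = z^-1.
Proof. by move=> z1; rewrite invC_norm z1 expr1n invr1 mul1r. Qed.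

Lemma sqdot_conj (h : 'I_5 -> 'I_5 -> C) i j : (forall i k, `|h i k| = 1) ->
  (sqdot h i j)^* = sqdot h j i.
Proof.
move=> hu; rewrite /sqdot rmorph_sum; apply: eq_bigr => k _ /=.
by rewrite rmorphXn rmorphM /= fmorphV /= !unitary_conj // invrK mulrC.
Qed.

Lemma sqdot_normM (h : 'I_5 -> 'I_5 -> C) i j : (forall i k, `|h i k| = 1) ->
  sqdot h i j * sqdot h j i = `|sqdot h i j| ^+ 2.
Proof. by move=> hu; rewrite normCK sqdot_conj. Qed.

(** One fixed pair of rows suffices: [type2_sqdot_block] gives all [p i j] and [q k l] with distinct
    indices the same modulus, so a single nonzero one makes them all nonzero. *)
Lemma hadamard5_sqdot (h : 'I_5 -> 'I_5 -> C) :
  type2 h -> (forall i k, `|h i k| = 1) -> sqdot h ord0 ord_max = 0.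
Proof.
move=> th hu; apply/eqP/negPn/negP => p0.
have [h0 _ _] := th; have tt := type2_transp th.
have tu i k : `|transp h i k| = 1 by rewrite /transp.
pose p := sqdot h; pose q := sqdot (transp h); pose g i k := h i k ^+ 2.
have g0 i k : g i k != 0 by rewrite expf_neq0.
have gu i k : `|g i k| = 1 by rewrite /g normrX hu expr1n.
have blk i j k l : i != j -> k != l ->
    p i j * g j k = q k l * g i l \/ p i j * g j l = q l k * g i k.
  by rewrite eq_sym (eq_sym k) => ij kl; apply: type2_sqdot_block.
have normp i j : `|p i j| = `|p j i|.
  by rewrite /p -(sqdot_conj _ _ hu) norm_conjC.
have normq i j : `|q i j| = `|q j i|.
  by rewrite /q -(sqdot_conj _ _ tu) norm_conjC.
have normpq i j k l : i != j -> k != l -> `|p i j| = `|q k l|.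
  move=> ij kl; have := blk i j k l ij kl.
  case=> /(congr1 (fun z => `|z|)); rewrite /= normrM [RHS]normrM !gu !mulr1 //.
  by rewrite (normq l k).
pose N := p ord0 ord_max * p ord_max ord0.
have pN i j : i != j -> p i j * p j i = N.
  move=> ij; rewrite /N /p !sqdot_normM // -/p.
  by rewrite (normpq i j ord0 ord_max) // (normpq ord0 ord_max ord0 ord_max).
have qN i j : i != j -> q i j * q j i = N.
  move=> ij; rewrite /N /p /q !sqdot_normM // -/p -/q.
  by rewrite (normpq ord0 ord_max i j).
have N0 : N != 0 by rewrite /N /p sqdot_normM // expf_neq0 // normr_eq0.
have pn0 i j : i != j -> p i j != 0.
  by move/pN => e; apply: contraNneq N0 => p00; rewrite -e p00 mul0r.
(* W i j k and V k l i are twice the real parts of the p and q normalised at an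
   entry; [blk] matches them in pairs on every 2x2 minor, so W is additive in
   (i, j), V in (k, l), with the same matrix y, whose 2x2 minors are crossed. *)
pose W i j k := p i j * g j k / g i k + p j i * g i k / g j k.
pose V k l i := q k l * g i l / g i k + q l k * g i k / g i l.
have WV_S i j k l : i != j -> k != l -> p i j * g j k = q k l * g i l ->
    W i j k = V k l i /\ W i j l = V k l j.
  move=> ij kl e.
  have ep : p i j = q k l * g i l / g j k by rewrite -e mulfK.
  have ep' : p j i = q l k * g j k / g i l.
    apply: (mulfI (pn0 _ _ ij)); rewrite pN // -(qN _ _ kl) ep; field.
    by rewrite !g0.
  by rewrite /W /V ep ep'; split; field; rewrite !g0.
have VC k l i : V k l i = V l k i by rewrite /V addrC.
have WV_R i j k l : i != j -> k != l -> p i j * g j l = q l k * g i k ->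
    W i j k = V k l j /\ W i j l = V k l i.
  rewrite (eq_sym k) => ij lk e; have [-> ->] := WV_S i j l k ij lk e.
  by rewrite !(VC l k).
have sumg i j : \sum_k g i k / g j k = p i j.
  by rewrite /p /sqdot; apply: eq_bigr => l _; rewrite expr_div_n.
have sumW i j : i != j -> \sum_k W i j k = N *+ 2.
  move=> ij; rewrite /W big_split /=.
  under eq_bigr do rewrite -mulrA.
  under [X in _ + X]eq_bigr do rewrite -mulrA.
  by rewrite -!mulr_sumr !sumg // pN // (pN j i) 1?eq_sym.
have sumV k l : k != l -> \sum_i V k l i = N *+ 2.
  move=> kl; rewrite /V big_split /=.
  under eq_bigr do rewrite -mulrA.
  under [X in _ + X]eq_bigr do rewrite -mulrA.
  rewrite -!mulr_sumr.
  have sumq k' l' : \sum_i g i k' / g i l' = q k' l'.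
    by rewrite /q /sqdot; apply: eq_bigr => i _; rewrite expr_div_n.
  by rewrite !sumq qN // (qN l k) 1?eq_sym.
have [|y [Wy Vy sumy]] := @additive_matrix C W V N sumW sumV.
  move=> i j k l ij kl; have [] := blk i j k l ij kl => [/(WV_S _ _ _ _ ij kl)|/(WV_R _ _ _ _ ij kl)].
    by case=> -> ->.
  by case=> -> ->; rewrite addrC.
have [|v [yv acv]] := @crossed_matrix C y.
  move=> i j k l ij kl.
  have [/WV_S|/WV_R] := blk i j k l ij kl => /(_ ij kl)[e _]; move: e; rewrite Wy // Vy //.
    by move/addrI => ->; right.
  by rewrite (addrC (y j k)); move/addIr => ->; left.
have ymax i k : y i k != v -> forall l, l != k -> y i l = v.
  by move=> yk l lk; case: (acv i l k lk) => // e; rewrite e eqxx in yk.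
have sumv i k : y i k != v -> y i k + v *+ 4 = N.
  move=> yk; rewrite -(sumy i) (bigD1 k) //=; congr (_ + _).
  rewrite (eq_bigr (fun=> v)) => [|l lk]; last exact: ymax yk l lk.
  by rewrite sumr_const (eq_card (B := predC1 k)) // cardC1 card_ord.
have [Nv|Nv] := eqVneq N (v *+ 5).
  have yvv i k : y i k = v.
    apply/eqP/negPn/negP => yk; move/negP: (yk); apply; apply/eqP.
    by apply: (addIr (v *+ 4)); rewrite sumv // Nv mulrSr addrC.
  have [_ r _] := th; have := r ord0 ord_max isT; apply/eqP.
  apply: (@sum5_neq0 C _ (p ord0 ord_max) (p ord_max ord0) (v *+ 2)) => //.
  - by move=> k; rewrite normf_div !hu divr1.
  - exact: pn0.
  - move=> k; transitivity (W ord0 ord_max k); last by rewrite Wy // !yvv.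
    by rewrite /W /g; field; rewrite !h0.
(* From here on, after permuting the columns by s, only the diagonal of y
   differs from v. *)
have exc i : exists k, y i k != v.
  apply/existsP; rewrite -[[exists _, _]]negbK negb_exists; apply/negP => /forallP all_v.
  move/eqP: Nv; apply; rewrite -(sumy i) (eq_bigr (fun=> v)) => [|k _].
    by rewrite sumr_const card_ord.
  by apply/eqP/negPn; exact: all_v.
pose s i := xchoose (exc i).
have ys i : y i (s i) != v := xchooseP (exc i).
have s_inj : injective s.
  move=> i j sij; apply/eqP/negPn/negP => ij.
  have [e|e] := yv i j (s i) ij; first by have := ys i; rewrite e eqxx.
  by have := ys j; rewrite -sij e eqxx.
have yoff i k : i != k -> y i (s k) = v.
  by move=> ik; apply: (ymax i (s i) (ys i)); rewrite (inj_eq s_inj) eq_sym.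
have ydiag i : y i (s i) = N - v *+ 4 by rewrite -(sumv i (s i)) ?addrK.
pose h' i k := h i (s k).
have th' : type2 h'.
  have [_ r c] := th; split=> [i k|i j ij|k l kl]; first exact: h0.
    rewrite -[RHS](r i j ij) [RHS](reindex s) //.
    exact: onW_bij (injF_bij s_inj).
  by apply: c; rewrite (inj_eq s_inj).
have sq' i j : sqdot h' i j = p i j.
  rewrite /p /sqdot [RHS](reindex s) //; exact: onW_bij (injF_bij s_inj).
(* The crossed alternative of [blk] would give [y i (s i) = y j (s l) = v], so the straight one
   holds. *)
have pq i j l : i != j -> i != l -> j != l ->
    p i j * g j (s i) = q (s i) (s l) * g i (s l).
  move=> ij il jl; have sil : s i != s l by rewrite (inj_eq s_inj).
  have [//|/WV_R] := blk i j (s i) (s l) ij sil; case=> //.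
  rewrite Wy // Vy // => e _.
  have e' : y i (s i) = y j (s l) by apply: (addIr (y j (s i))); rewrite e addrC.
  by have := ys i; rewrite e' yoff ?eqxx.
pose nb (i : 'I_5) : 'I_5 := if i == ord0 then ord_max else ord0.
have nbn i : i != nb i by rewrite /nb; case: (eqVneq i ord0) => [->|].
pose kap i := p i (nb i) * g (nb i) (s i).
(* The right side of [pq] does not involve [j], so two choices of [j] are compared through an [l]
   different from both. *)
have kapE i j : i != j -> p i j * g j (s i) = kap i.
  move=> ij; have [k [l [m]]] := ord5_complete ij; rewrite /= !inE !negb_or.
  case/and5P=> /and4P[_ ik il _] /and3P[jk jl _] /andP[kl _] _ _.
  have [nk|nk] := eqVneq (nb i) k.
    by rewrite (pq i j l) // -(pq i (nb i) l) // nk.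
  by rewrite (pq i j k) // -(pq i (nb i) k).
(* [W] is [y i k + y j k]: an exceptional entry plus [v] on the diagonal, [v + v] away from it. *)
apply: (@potts_false C h' N (N - v *+ 4 + v) (v + v) kap) => //.
- by move=> i k; rewrite /h'.
- by move=> i j ij; rewrite !sq' pN.
- by move=> i j ij; rewrite sq' kapE.
- move=> i; have ij := nbn i; move: (nb i) ij => j ij.
  rewrite -{1}(ydiag i) -{1}(yoff j i) 1?eq_sym // -Wy // /W -(kapE i j ij) -(pN i j ij).
  rewrite /h' -!/(g _ _); field; by rewrite !g0 pn0.
- move=> i j k ij ik jk.
  rewrite -{1}(yoff i k) // -{1}(yoff j k) // -Wy // /W -(kapE i j ij) -(pN i j ij).
  rewrite /h' -!/(g _ _); field; by rewrite !g0 pn0.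
Qed.
End Hadamard5.

(** * Tilings from characters *)

Section Tilings.
Variables (F : fieldType) (d : nat).
Implicit Type chi : 'rV[int]_d -> F.

Definition is_character chi :=
  (forall x, chi x != 0) /\ (forall x y, chi (x + y) = chi x * chi y).

Lemma is_characterB chi x y : is_character chi -> chi (x - y) = chi x / chi y.
Proof.
by case=> chi0 chiD; rewrite -[x in RHS](subrK y) (chiD (x - y)) mulfK.
Qed.

(* [choose] depends only on the extension of its predicate, hence selects one
   point in each fibre of z |-> z ^+ n. *)
Definition fibre_rep n (z : F) : bool :=
  choose (fun w : F => w ^+ n == z ^+ n) z == z.

Lemma fibre_rep_choose n z :
  exists2 w : F, w ^+ n = z ^+ n & fibre_rep n w.
Proof.
pose P w := w ^+ n == z ^+ n; have Pz : P z by rewrite /P.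
have Pw := chooseP Pz; exists (choose P z); first exact/eqP.
rewrite /fibre_rep (eqP Pw) -/P; apply/eqP; exact: choose_id.
Qed.

Lemma fibre_rep_inj n z w : z ^+ n = w ^+ n -> fibre_rep n z -> fibre_rep n w -> z = w.
Proof.
move=> e /eqP <- /eqP <-; rewrite e.
by apply: choose_id; rewrite ?e.
Qed.

(** The [size A] values of [chi] on [A] are all the roots of [X^n - c], so [chi (x - a)] runs
    through one whole fibre of the power map as [a] varies, and meets its representative once. *)
Lemma fibre_coset_tiles chi (A : seq 'rV[int]_d) (c : F) :
  is_character chi -> uniq A -> (0 < size A)%N -> {in A &, injective chi} ->
  {in A, forall a, chi a ^+ size A = c} -> tiles A.
Proof.
move=> chiM uA sA chi_inj chiA; have [chi0 chiD] := chiM.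
set n := size A in sA chiA.
have roots z : z ^+ n = c -> z \in map chi A.
  move=> zc; apply/negPn/negP => zA.
  have p0 : 'X^n - c%:P != 0 :> {poly F} by rewrite -size_poly_eq0 size_XnsubC.
  have := @max_poly_roots _ _ (z :: map chi A) p0.
  rewrite size_XnsubC // [size (_ :: _)]/= size_map ltnn => H.
  suff: false by []; apply: H; last by rewrite /= zA map_inj_in_uniq.
  apply/allP => y; rewrite inE rootE !hornerE => /predU1P[->|/mapP[a aA ->]].
    by rewrite zc subrr.
  by rewrite chiA // subrr.
exists (fun t => fibre_rep n (chi t)) => x.
have [a0 a0A] : exists a, a \in A by exists (nth 0 A 0); apply: mem_nth.
(* The fibre of [chi x / chi a0] is the same for every point of [A] in place of [a0]. *)
have [w wn wr] := fibre_rep_choose n (chi x / chi a0).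
have w0 : w != 0.
  have : w ^+ n != 0 by rewrite wn expf_neq0 // mulf_neq0 ?invr_eq0.
  by rewrite expf_eq0 sA.
have [a aA ea] : exists2 a, a \in A & chi x / w = chi a.
  apply/mapP/roots; rewrite expr_div_n wn expr_div_n (chiA _ a0A).
  by rewrite invf_div mulrCA divff ?mulr1 // expf_neq0.
exists (x - a); split.
  rewrite is_characterB // -ea subKr; split=> //.
  by rewrite invf_div mulrCA divff ?mulr1.
move=> t; have [a' ->] : exists a', t = x - a'.
  by exists (x - t); rewrite subKr.
rewrite subKr => -[tr a'A]; congr (x - _); apply: chi_inj => //.
rewrite is_characterB // in tr.
have ew : w = chi x / chi a'.
  by apply: (fibre_rep_inj _ wr tr); rewrite wn !expr_div_n (chiA _ a0A) (chiA _ a'A).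
by rewrite -ea ew invf_div mulrCA divff ?mulr1.
Qed.

Lemma fibre_rep_opp (z : F) : 2 != 0 :> F -> z != 0 -> fibre_rep 2 (- z) = ~~ fibre_rep 2 z.
Proof.
move=> n2 z0; have [w wz wr] := fibre_rep_choose 2 z.
have zNz : z != - z.
  by rewrite -subr_eq0 opprK -mulr2n -mulr_natl mulf_neq0.
have nz : ~~ (fibre_rep 2 z && fibre_rep 2 (- z)).
  apply/negP => /andP[r1 r2]; move/eqP: zNz; apply.
  by apply: (@fibre_rep_inj 2); rewrite ?sqrrN.
move/eqP: wz; rewrite eqf_sqr => /orP[] /eqP e; rewrite e in wr; rewrite wr in nz *.
  by apply/negbTE.
by rewrite andbT in nz; rewrite nz.
Qed.

(** The complement asks both values to be the chosen one of [{z, -z}]: [chi2] selects the pair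
    [{a, b}] or [{c, e}], then [chi1] selects the point in the pair. *)
Lemma two_pairs_tiles chi1 chi2 (A : seq 'rV[int]_d) a b c e : 2 != 0 :> F ->
  is_character chi1 -> is_character chi2 -> A =i [:: a; b; c; e] ->
  chi2 b = chi2 a -> chi2 c = - chi2 a -> chi2 e = - chi2 a ->
  chi1 b = - chi1 a -> chi1 e = - chi1 c -> tiles A.
Proof.
move=> n2 m1 m2 eA c2b c2c c2e c1b c1e.
have n1 := m1.1; have n2' := m2.1.
pose D := fibre_rep 2 : F -> bool.
have DN z : z != 0 -> D (- z) = ~~ D z by exact: fibre_rep_opp.
exists (fun t => D (chi1 t) && D (chi2 t)) => x.
have key u : u \in A -> D (chi1 (x - u)) && D (chi2 (x - u)) ->
  (forall v, v \in A -> D (chi1 (x - v)) && D (chi2 (x - v)) -> v = u) ->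
  exists! t, (D (chi1 t) && D (chi2 t)) /\ x - t \in A.
  move=> uA Du un; exists (x - u); split; first by rewrite subKr.
  move=> t [Dt tA]; rewrite -(un (x - t)) //; first by rewrite subKr.
  by rewrite subKr.
pose z1 u := chi1 x / chi1 u; pose z2 := chi2 x / chi2 a.
have z10 u : z1 u != 0 by rewrite mulf_neq0 ?invr_eq0.
have z20 : z2 != 0 by rewrite mulf_neq0 ?invr_eq0.
have Da : D (chi1 (x - a)) && D (chi2 (x - a)) = D (z1 a) && D z2.
  by rewrite !is_characterB.
have Db : D (chi1 (x - b)) && D (chi2 (x - b)) = ~~ D (z1 a) && D z2.
  by rewrite !is_characterB // c2b c1b invrN mulrN (DN _ (z10 a)).
have Dc : D (chi1 (x - c)) && D (chi2 (x - c)) = D (z1 c) && ~~ D z2.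
  by rewrite !is_characterB // c2c invrN mulrN (DN _ z20).
have De : D (chi1 (x - e)) && D (chi2 (x - e)) = ~~ D (z1 c) && ~~ D z2.
  by rewrite !is_characterB // c2e c1e !invrN !mulrN (DN _ z20) (DN _ (z10 c)).
have wit u : u \in [:: a; b; c; e] -> D (chi1 (x - u)) && D (chi2 (x - u)) ->
  (forall v, v \in [:: a; b; c; e] ->
     D (chi1 (x - v)) && D (chi2 (x - v)) -> v = u) ->
  exists! t, (D (chi1 t) && D (chi2 t)) /\ x - t \in A.
  move=> uA Du un; apply: (key u) => // [|v]; first by rewrite eA.
  by rewrite eA; exact: un.
have [h2|h2] := boolP (D z2); [have [h1|h1] := boolP (D (z1 a))|have [h1|h1] := boolP (D (z1 c))].
- apply: (wit a); rewrite ?inE ?eqxx ?orbT ?Da ?h1 ?h2 // => v.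
  by rewrite !inE => /or4P[] /eqP -> //; rewrite ?Db ?Dc ?De ?h1 ?h2 ?andbF.
- apply: (wit b); rewrite ?inE ?eqxx ?orbT ?Db ?h1 ?h2 // => v.
  by rewrite !inE => /or4P[] /eqP -> //; rewrite ?Da ?Dc ?De ?h2 ?andbF ?(negPf h1).
- apply: (wit c); rewrite ?inE ?eqxx ?orbT ?Dc ?h1 ?h2 // => v.
  by rewrite !inE => /or4P[] /eqP -> //; rewrite ?Da ?Db ?De ?h1 ?(negPf h2) ?andbF.
- apply: (wit e); rewrite ?inE ?eqxx ?orbT ?De ?h1 ?h2 // => v.
  by rewrite !inE => /or4P[] /eqP -> //; rewrite ?Da ?Db ?Dc ?(negPf h1) ?(negPf h2) ?andbF.
Qed.
End Tilings.

(** * The Hadamard matrix of a spectral set *)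

Section Characters.
Variables (R : realType) (d : nat).
Implicit Types (l m : 'rV[R]_d) (x y : 'rV[int]_d) (A : seq 'rV[int]_d).

Lemma echarD l x y : echar l (x + y) = echar l x * echar l y.
Proof.
have -> : echar l (x + y) = Complex (cos (2 * pi * dotZ l x + 2 * pi * dotZ l y))
    (sin (2 * pi * dotZ l x + 2 * pi * dotZ l y)).
  rewrite /echar -mulrDr /dotZ -big_split /=.
  suff -> : \sum_(i < d) l 0 i * ((x + y) 0 i)%:~R =
    \sum_(i < d) (l 0 i * (x 0 i)%:~R + l 0 i * (y 0 i)%:~R) by [].
  by apply: eq_bigr => i _; rewrite mxE intrD mulrDr.
rewrite cosD sinD /echar; apply/eqP; rewrite eq_complex /=; apply/andP; split; apply/eqP; ring.
Qed.

Lemma echar_norm l x : `|echar l x| = 1.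
Proof.
apply/eqP; rewrite -sqrp_eq1 // normCK; apply/eqP/eqP.
rewrite eq_complex /=; apply/andP; split; apply/eqP; last by ring.
by rewrite mulrN opprK -!expr2 cos2Dsin2.
Qed.

Lemma echar_neq0 l x : echar l x != 0.
Proof. by rewrite -normr_gt0 echar_norm. Qed.

Lemma echar_conj l x : (echar l x)^* = (echar l x)^-1.
Proof. by rewrite unitary_conj ?echar_norm. Qed.

Lemma echar_ratio l m : is_character (fun x => echar l x / echar m x).
Proof.
split=> [x|x y]; first by rewrite mulf_neq0 ?invr_eq0 ?echar_neq0.
by rewrite !echarD; field; rewrite !echar_neq0.
Qed.

(** The basis property makes the matrix of characters square; row orthogonality gives a one-sided
    inverse, which is two-sided, and this is column orthogonality. *)
Lemma spectral_matrix A n : uniq A -> size A = n -> spectral R A ->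
  exists l : 'I_n -> 'rV[R]_d,
    (forall i j, i != j -> \sum_(k < n) echar (l i) A`_k / echar (l j) A`_k = 0) /\
    (forall k k' : 'I_n, k != k' ->
       \sum_i echar (l i) A`_k / echar (l i) A`_k' = 0).
Proof.
move=> uA <- {n} [Lam [uL _ [orth indep span]]].
pose M := \matrix_(i < size Lam, k < size A) echar Lam`_i A`_k.
have free : row_free M.
  apply: inj_row_free => v vM.
  (* Independence is stated for coefficients indexed by points, so the vector [v] is transported to
     [Lam]; as [Lam] is duplicate-free, each sum has one term. *)
  pose c l := \sum_(i < size Lam | Lam`_i == l) v 0 i.
  have cE (i : 'I_(size Lam)) : c Lam`_i = v 0 i.
    rewrite /c (bigD1 i) //= big1 ?addr0 // => j /andP[/eqP e ji].
    by move: ji; rewrite -val_eqE /= -(nth_uniq 0 _ _ uL) // e eqxx.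
  have c0 : {in Lam, forall l, c l = 0}.
    apply: indep => a /(nthP 0)[k kA <-]; rewrite (big_nth 0) big_mkord.
    move/matrixP: vM => /(_ 0 (Ordinal kA)); rewrite !mxE => e; rewrite -[RHS]e.
    by apply: eq_bigr => i _; rewrite cE mxE.
  by apply/rowP => i; rewrite mxE -cE c0 // mem_nth.
have full : row_full M.
  have /fin_all_exists[c cP] : forall k : 'I_(size A), exists c : 'rV[R]_d -> R[i],
      forall k' : 'I_(size A), (k == k')%:R = \sum_(i < size Lam) c Lam`_i * echar Lam`_i A`_k'.
    (* Expanding the indicator of each point of [A] yields a left inverse of [M]. *)
    move=> k; have [c cP] := span (fun a => (A`_k == a)%:R).
    exists c => k'; have := cP _ (mem_nth 0 (ltn_ord k')).
    by rewrite nth_uniq // (big_nth 0) big_mkord.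
  apply/row_fullP; exists (\matrix_(k, i) c k Lam`_i).
  by apply/matrixP => k k'; rewrite !mxE cP; apply: eq_bigr => i _; rewrite !mxE.
have sE : size Lam = size A.
  by apply/eqP; rewrite -[X in X == _](eqP free) (eqP full).
have roworth (i j : 'I_(size A)) : i != j ->
    \sum_(k < size A) echar Lam`_i A`_k / echar Lam`_j A`_k = 0.
  move=> ij; have := orth Lam`_i Lam`_j; rewrite !mem_nth ?sE // nth_uniq ?sE //.
  move=> /(_ isT isT ij); rewrite /l2dot (big_nth 0) big_mkord => e; rewrite -[RHS]e.
  by apply: eq_bigr => k _; rewrite echar_conj.
exists (fun i => Lam`_i); split=> // k k' kk'.
have n0 : (size A)%:R != 0 :> R[i] by rewrite pnatr_eq0 -lt0n (leq_ltn_trans _ (ltn_ord k)).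
pose H := \matrix_(i < size A, k < size A) echar Lam`_i A`_k.
pose H' := \matrix_(k < size A, i < size A) ((size A)%:R^-1 / echar Lam`_i A`_k).
have HH' : H *m H' = 1%:M.
  apply/matrixP => i j; rewrite !mxE.
  transitivity ((size A)%:R^-1 * \sum_(k < size A) echar Lam`_i A`_k / echar Lam`_j A`_k).
    by rewrite mulr_sumr; apply: eq_bigr => u _; rewrite !mxE mulrCA.
  have [->|ij] := eqVneq i j; last by rewrite roworth // mulr0.
  rewrite (eq_bigr (fun=> 1)) => [|u _]; last by rewrite divff // echar_neq0.
  by rewrite sumr_const card_ord mulVf.
have /matrixP/(_ k' k) := mulmx1C HH'.
rewrite !mxE eq_sym (negPf kk') => e; apply: (mulfI (invr_neq0 n0)).
rewrite mulr0 -[RHS]e mulr_sumr; apply: eq_bigr => i _; rewrite !mxE.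
by rewrite mulrCA mulrC mulrAC mulrC mulrA.
Qed.
End Characters.

(** * Spectral sets with at most five points *)

Section VanishingSums.
Variable F : numFieldType.
Implicit Types a b x y z : F.

Lemma vanishing2 x y : x != 0 -> x + y = 0 -> x != y /\ x ^+ 2 = y ^+ 2.
Proof.
move=> x0 /eqP; rewrite addrC addr_eq0 => /eqP ->; split; last by rewrite sqrrN.
by rewrite -subr_eq0 opprK -mulr2n -mulr_natl mulf_neq0 // pnatr_eq0.
Qed.

(** Here [e1 = e2 = 0], which leaves [x^2 + x * y + y^2 = 0]. *)
Lemma vanishing3 x y z : x != 0 -> y != 0 -> z != 0 ->
  x + y + z = 0 -> x^-1 + y^-1 + z^-1 = 0 -> x != y /\ x ^+ 3 = y ^+ 3.
Proof.
move=> x0 y0 z0 e1 e2'.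
have e2 : x * y + y * z + z * x = 0.
  have -> : x * y + y * z + z * x = x * y * z * (x^-1 + y^-1 + z^-1).
    by field; rewrite x0 y0 z0.
  by rewrite e2' mulr0.
have q : x ^+ 2 + x * y + y ^+ 2 = 0.
  transitivity ((x + y) * (x + y + z) - (x * y + y * z + z * x)); first by ring.
  by rewrite e1 e2; ring.
split; last first.
  apply/eqP; rewrite -subr_eq0; apply/eqP.
  transitivity ((x - y) * (x ^+ 2 + x * y + y ^+ 2)); first by ring.
  by rewrite q mulr0.
apply/eqP => xy; have /eqP : 3 * y ^+ 2 = 0 by rewrite -[RHS]q xy; ring.
by rewrite mulf_eq0 pnatr_eq0 expf_eq0 (negPf y0).
Qed.

(* Newton's identities turn the four hypotheses into e1 = e2 = e3 = e4 = 0, so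
   that the five numbers are the roots of X^5 - e5. *)
Lemma vanishing5 a b x y z :
  a != 0 -> b != 0 -> x != 0 -> y != 0 -> z != 0 ->
  a + b + x + y + z = 0 -> a^-1 + b^-1 + x^-1 + y^-1 + z^-1 = 0 ->
  a ^+ 2 + b ^+ 2 + x ^+ 2 + y ^+ 2 + z ^+ 2 = 0 ->
  a^-1 ^+ 2 + b^-1 ^+ 2 + x^-1 ^+ 2 + y^-1 ^+ 2 + z^-1 ^+ 2 = 0 ->
  a != b /\ a ^+ 5 = b ^+ 5.
Proof.
move=> a0 b0 x0 y0 z0 e1 e1' p2 p2'.
have n2 : 2 != 0 :> F by rewrite pnatr_eq0.
pose e2 (a b x y z : F) := a * b + a * x + a * y + a * z + b * x + b * y + b * z
  + x * y + x * z + y * z.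
have e2_0 u v w s t : u + v + w + s + t = 0 ->
    u ^+ 2 + v ^+ 2 + w ^+ 2 + s ^+ 2 + t ^+ 2 = 0 -> e2 u v w s t = 0.
  move=> h1 h2; apply: (mulfI n2); rewrite mulr0.
  transitivity ((u + v + w + s + t) ^+ 2 - (u ^+ 2 + v ^+ 2 + w ^+ 2 + s ^+ 2 + t ^+ 2)).
    by rewrite /e2; ring.
  by rewrite h1 h2; ring.
have h2 := e2_0 _ _ _ _ _ e1 p2.
have h2' := e2_0 _ _ _ _ _ e1' p2'.
pose P := a * b * x * y * z.
have h4 : P * (a^-1 + b^-1 + x^-1 + y^-1 + z^-1) = 0 by rewrite e1' mulr0.
have h3 : P * e2 a^-1 b^-1 x^-1 y^-1 z^-1 = 0 by rewrite h2' mulr0.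
have aP : a ^+ 5 = P.
  apply/eqP; rewrite -subr_eq0; apply/eqP.
  (* [a] is a root of the monic quintic with the five given roots; [e3] and [e4] are written as [P]
     times symmetric functions of the inverses. *)
  transitivity ((a + b + x + y + z) * a ^+ 4 - e2 a b x y z * a ^+ 3
    + (P * e2 a^-1 b^-1 x^-1 y^-1 z^-1) * a ^+ 2
    - (P * (a^-1 + b^-1 + x^-1 + y^-1 + z^-1)) * a).
    by rewrite /P /e2; field; rewrite a0 b0 x0 y0 z0.
  by rewrite h3 h4 h2 e1; ring.
have bP : b ^+ 5 = P.
  apply/eqP; rewrite -subr_eq0; apply/eqP.
  transitivity ((a + b + x + y + z) * b ^+ 4 - e2 a b x y z * b ^+ 3
    + (P * e2 a^-1 b^-1 x^-1 y^-1 z^-1) * b ^+ 2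
    - (P * (a^-1 + b^-1 + x^-1 + y^-1 + z^-1)) * b).
    by rewrite /P /e2; field; rewrite a0 b0 x0 y0 z0.
  by rewrite h3 h4 h2 e1; ring.
split; last by rewrite aP bP.
rewrite -subr_eq0; apply/eqP => ab.
(* The product of the differences is the derivative of that quintic at [a]. *)
have /eqP : 5 * a ^+ 4 = 0.
  transitivity ((a - b) * (a - x) * (a - y) * (a - z)
    + 4 * (a + b + x + y + z) * a ^+ 3 - 3 * e2 a b x y z * a ^+ 2
    + 2 * (P * e2 a^-1 b^-1 x^-1 y^-1 z^-1) * a
    - P * (a^-1 + b^-1 + x^-1 + y^-1 + z^-1)).
    by rewrite /P /e2; field; rewrite a0 b0 x0 y0 z0.
  by rewrite h3 h4 h2 e1 ab; ring.
by rewrite mulf_eq0 pnatr_eq0 expf_eq0 (negPf a0).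
Qed.

(** Since [e1 = e3 = 0], [(a + x) * (a + y) * (a + z) = a^2 * e1 + e3] vanishes. *)
Lemma vanishing4 a x y z : a != 0 -> x != 0 -> y != 0 -> z != 0 ->
  a + x + y + z = 0 -> a^-1 + x^-1 + y^-1 + z^-1 = 0 ->
  [\/ x = - a /\ z = - y, y = - a /\ z = - x | z = - a /\ y = - x].
Proof.
move=> a0 x0 y0 z0 e1 e1'.
have : (a + x) * ((a + y) * (a + z)) = 0.
  transitivity (a ^+ 2 * (a + x + y + z) + a * x * y * z * (a^-1 + x^-1 + y^-1 + z^-1)
    - a * 0); last by rewrite e1 e1'; ring.
  by field; rewrite a0 x0 y0 z0.
move/eqP; rewrite !mulf_eq0 => /or3P[] /eqP e; [constructor 1|constructor 2|constructor 3].
- by split; apply/eqP; rewrite -addr_eq0; apply/eqP; [rewrite -[RHS]e; ring|];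
  transitivity (a + x + y + z - (a + x)); [ring|rewrite e1 e subrr].
- by split; apply/eqP; rewrite -addr_eq0; apply/eqP; [rewrite -[RHS]e; ring|];
  transitivity (a + x + y + z - (a + y)); [ring|rewrite e1 e subrr].
- by split; apply/eqP; rewrite -addr_eq0; apply/eqP; [rewrite -[RHS]e; ring|];
  transitivity (a + x + y + z - (a + z)); [ring|rewrite e1 e subrr].
Qed.
End VanishingSums.

(** * Tilings for each cardinality *)

Section Assembly.
Variables (R : realType) (d : nat).
Implicit Types (A : seq 'rV[int]_d).
Let C : numClosedFieldType := R[i].

Lemma index_tiles n (chi : 'rV[int]_d -> C) A : is_character chi -> uniq A ->
  size A = n.+1 ->
  (forall i j : 'I_n.+1, i != j ->
     chi A`_i != chi A`_j /\ chi A`_i ^+ n.+1 = chi A`_j ^+ n.+1) ->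
  tiles A.
Proof.
move=> chiM uA sA H.
apply: (@fibre_coset_tiles C d chi A (chi A`_0 ^+ n.+1)); rewrite ?sA //.
  move=> _ _ /(nthP 0)[i iA <-] /(nthP 0)[j jA <-]; rewrite sA in iA jA => e.
  have [ij|/H[]] := eqVneq (Ordinal iA) (Ordinal jA).
    by move/(congr1 val): ij => /= ->.
  by rewrite /= e eqxx.
move=> _ /(nthP 0)[i iA <-]; rewrite sA in iA.
by have [/(congr1 val)/= ->|/H[]] := eqVneq (Ordinal iA) ord0.
Qed.

Lemma spectral2_tiles A : uniq A -> size A = 2%N -> spectral R A -> tiles A.
Proof.
move=> uA sA /(spectral_matrix uA sA)[l [row _]].
have chiM := echar_ratio (l ord0) (l ord_max).
apply: (index_tiles chiM uA sA) => i j ij.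
apply: vanishing2; first exact: chiM.1.
have u : uniq [:: i; j] by rewrite /= inE ij.
by rewrite -(row ord0 ord_max isT) (big_ord_uniq _ u) // !big_cons big_nil addr0.
Qed.

Lemma spectral3_tiles A : uniq A -> size A = 3%N -> spectral R A -> tiles A.
Proof.
move=> uA sA /(spectral_matrix uA sA)[l [row _]].
have chiM := echar_ratio (l ord0) (l ord_max).
apply: (index_tiles chiM uA sA) => i j ij.
have [|s' [us ss]] := @ord_complete 3 [:: i; j]; first by rewrite /= inE ij.
case: s' us ss => [|k [|? ?]] u //= _.
apply: (@vanishing3 _ _ _ (echar (l ord0) A`_k / echar (l ord_max) A`_k));
  rewrite ?(chiM.1) //.
  by rewrite -(row ord0 ord_max isT) (big_ord_uniq _ u) // !big_cons big_nil addr0 addrA.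
rewrite !invf_div.
by rewrite -(row ord_max ord0 isT) (big_ord_uniq _ u) // !big_cons big_nil addr0 addrA.
Qed.

Lemma spectral5_tiles A : uniq A -> size A = 5%N -> spectral R A -> tiles A.
Proof.
move=> uA sA /(spectral_matrix uA sA)[l [row col]].
pose h (i k : 'I_5) : C := echar (l i) A`_k.
have h0 i k : h i k != 0 by exact: echar_neq0.
have hu i k : `|h i k| = 1 by exact: echar_norm.
have th : type2 h by split.
have p1 := hadamard5_sqdot th hu.
have p2 : sqdot h ord_max ord0 = 0 by rewrite -sqdot_conj // p1 rmorph0.
have chiM := echar_ratio (l ord0) (l ord_max).
apply: (index_tiles chiM uA sA) => i j ij.
have [k [m [n u]]] := ord5_complete ij.
apply: (@vanishing5 _ _ _ (h ord0 k / h ord_max k) (h ord0 m / h ord_max m)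
  (h ord0 n / h ord_max n)); rewrite ?(chiM.1) ?invf_div //.
- by rewrite -(row ord0 ord_max isT) (big_ord5 _ u).
- by rewrite -(row ord_max ord0 isT) (big_ord5 _ u).
- by rewrite -[RHS]p1 /sqdot (big_ord5 _ u).
- by rewrite -[RHS]p2 /sqdot (big_ord5 _ u).
Qed.

(* x splits A into two pairs on which it takes opposite values; the remaining
   orthogonality relations give a second ratio of characters that is constant up
   to sign and separates two such pairs. *)
Lemma spectral4_tiles A : uniq A -> size A = 4%N -> spectral R A -> tiles A.
Proof.
move=> uA sA /(spectral_matrix uA sA)[l [row _]].
pose o n (ltn4 : (n < 4)%N) := Ordinal ltn4.
pose i0 := o 0 isT; pose i1 := o 1 isT; pose i2 := o 2 isT.
pose x (a : 'rV[int]_d) : C := echar (l i1) a / echar (l i0) a.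
pose y (a : 'rV[int]_d) : C := echar (l i2) a / echar (l i0) a.
pose z (a : 'rV[int]_d) : C := echar (l i1) a / echar (l i2) a.
have xM : is_character x := echar_ratio _ _.
have yM : is_character y := echar_ratio _ _.
have zM : is_character z := echar_ratio _ _.
have n2 : 2 != 0 :> C by rewrite pnatr_eq0.
have zE a : z a = x a / y a.
  by rewrite /x /y /z; field; rewrite !echar_neq0.
have sum4 (F : 'rV[int]_d -> C) a b c e : A =i [:: a; b; c; e] -> 
    \sum_(k < 4) F A`_k = F a + F b + F c + F e.
  move=> eA; rewrite -sA -(big_mkord xpredT (fun k => F A`_k)) -(big_nth 0 xpredT).
  have uq : uniq [:: a; b; c; e] by rewrite (uniq_size_uniq uA eA) sA.
  by rewrite (perm_big _ (uniq_perm uA uq eA)) /= !big_cons big_nil addr0 !addrA.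
have sums a b c e : A =i [:: a; b; c; e] ->
    [/\ x a + x b + x c + x e = 0, y a + y b + y c + y e = 0,
        z a + z b + z c + z e = 0, (x a)^-1 + (x b)^-1 + (x c)^-1 + (x e)^-1 = 0 &
        (y a)^-1 + (y b)^-1 + (y c)^-1 + (y e)^-1 = 0].
  move=> eA; rewrite !invf_div; split.
  - by rewrite -(sum4 x _ _ _ _ eA); apply: row.
  - by rewrite -(sum4 y _ _ _ _ eA); apply: row.
  - by rewrite -(sum4 z _ _ _ _ eA); apply: row.
  - by rewrite -(sum4 (fun a => echar (l i0) a / echar (l i1) a) _ _ _ _ eA); apply: row.
  - by rewrite -(sum4 (fun a => echar (l i0) a / echar (l i2) a) _ _ _ _ eA); apply: row.
have swap1 a b c e : A =i [:: a; b; c; e] -> A =i [:: a; c; b; e].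
  by move=> eA u; rewrite eA !inE; do 4!case: (u == _).
have swap2 a b c e : A =i [:: a; b; c; e] -> A =i [:: a; b; e; c].
  by move=> eA u; rewrite eA !inE; do 4!case: (u == _).
have crossed a b c e : A =i [:: a; b; c; e] -> x b = - x a -> x e = - x c ->
    y c = - y a -> y e = - y b -> tiles A.
  move=> eA xb xe yc ye; have [_ _ s _ _] := sums _ _ _ _ eA.
  (* The vanishing sum of [z = x / y] factors; either factor makes [x] or [y] constant on pairs that
     the other one separates. *)
  have : (x a - x c) * ((y a)^-1 - (y b)^-1) = 0.
    by rewrite -[RHS]s !zE xb xe yc ye !invrN; ring.
  move/eqP; rewrite mulf_eq0 !subr_eq0 => /orP[/eqP xac|/eqP/invr_inj yab].
    apply: (@two_pairs_tiles C d y x A a c b e) => //; last by rewrite xe xac.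
    exact: swap1.
  by apply: (@two_pairs_tiles C d x y A a b c e) => //; rewrite ye yab.
have paired a b c e : A =i [:: a; b; c; e] -> x b = - x a -> x e = - x c -> tiles A.
  move=> eA xb xe; have [_ s1 sz _ s2] := sums _ _ _ _ eA.
  case: (vanishing4 (yM.1 a) (yM.1 b) (yM.1 c) (yM.1 e) s1 s2) => -[e1 e2].
  (* When [x] and [y] change sign on the same pairs, [z] is constant on each pair and its vanishing
     sum makes the two constants opposite. *)
  - have zb : z b = z a by rewrite !zE xb e1 invrN mulrNN.
    have zee : z e = z c by rewrite !zE xe e2 invrN mulrNN.
    have zc : z c = - z a.
      apply/eqP; rewrite -addr_eq0; apply/eqP/(mulfI n2); rewrite mulr0 -sz zb zee; ring.
    by apply: (@two_pairs_tiles C d x z A a b c e) => //; rewrite zee.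
  - exact: (crossed a b c e).
  - by apply: (crossed a b e c); rewrite ?xe ?opprK //; exact: swap2.
have [a [b [c [e eA]]]] : exists a b c e, A =i [:: a; b; c; e].
  by case: A sA {uA row sum4 sums swap1 swap2 crossed paired} => [|a [|b [|c [|e [|]]]]] // _;
    exists a, b, c, e.
have [s _ _ s' _] := sums _ _ _ _ eA.
case: (vanishing4 (xM.1 a) (xM.1 b) (xM.1 c) (xM.1 e) s s') => -[e1 e2].
- exact: (paired a b c e).
- by apply: (paired a c b e) => //; exact: swap1.
- by apply: (paired a e b c) => //; apply/swap1/swap2.
Qed.

Lemma singleton_tiles (a : 'rV[int]_d) : tiles [:: a].
Proof.
exists (fun=> True) => x; exists (x - a); split; first by rewrite subKr inE eqxx.
by move=> t [_]; rewrite inE => /eqP <-; rewrite subKr.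
Qed.
End Assembly.

Theorem theorem2p3 (R : realType) (d : nat) (A : seq 'rV[int]_d) :
  uniq A -> (0 < size A)%N -> (size A <= 5)%N ->
  spectral R A -> tiles A.
Proof.
move=> uA; case: (ltngtP (size A) 5) => // [|s5 _ _]; last exact: spectral5_tiles.
case eA : (size A) => [|[|[|[|[|]]]]] // _ _ _ spA.
- by case: A eA {uA spA} => [|a []] // _; exact: singleton_tiles.
- exact: spectral2_tiles spA.
- exact: spectral3_tiles spA.
- exact: spectral4_tiles spA.
Qed.
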